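(* If $q$ is odd and fixed, then, for each choice of sign in $\mathrm{O}^{\pm}$, $\mathrm{SO}^{\pm}$ (the same sign in both), $$\lim_{m\to\infty}\frac{i(\mathrm{O}^{\pm}(4m,q)\setminus\mathrm{SO}^{\pm}(4m,q))}{q^{(2m)^2}}=\frac12\left(\prod_{i\ge 1}(1+1/q^{2i-1})^2-\prod_{i\ge 1}(1-1/q^{2i-1})^2\right),$$ and $$\lim_{m\to\infty}\frac{i(\mathrm{O}^{\pm}(4m+2,q)\setminus\mathrm{SO}^{\pm}(4m+2,q))}{q^{(2m+1)^2}}=\frac12\left(\prod_{i\ge 1}(1+1/q^{2i-1})^2+\prod_{i\ge 1}(1-1/q^{2i-1})^2\right).$$
   Context: For $q$ an odd prime power and $\delta$ a fixed nonsquare in $\mathbb{F}_q^{\times}$: $\mathrm{O}^{+}(2n,q)$ is the isometry group on $\mathbb{F}_q^{2n}$ of the quadratic form $x_1x_2+x_3x_4+\cdots+x_{2n-1}x_{2n}$, and $\mathrm{O}^{-}(2n,q)$ is that of $x_1x_2+\cdots+x_{2n-3}x_{2n-2}+x_{2n-1}^2-\delta x_{2n}^2$. $\mathrm{SO}^{\pm}(2n,q)$ is the subgroup of determinant $1$ elements of $\mathrm{O}^{\pm}(2n,q)$. $i(X)$ denotes the number of $g\in X$ with $g^2=1$. *)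

(* Defs.v *)
From HB Require Import structures.
From mathcomp Require Import all_boot all_order all_algebra.
From mathcomp Require Import all_classical all_reals all_analysis.

Set Implicit Arguments.
Unset Strict Implicit.
Unset Printing Implicit Defensive.

Import Order.TTheory GRing.Theory Num.Theory.
Import numFieldNormedType.Exports.

Local Open Scope ring_scope.

Inductive sign := Plus | Minus.

Lemma ord_fst_subproof n (i : 'I_n) : (2 * i < 2 * n)%N.
Proof. by rewrite ltn_pmul2l. Qed.

Lemma ord_snd_subproof n (i : 'I_n) : ((2 * i).+1 < 2 * n)%N.
Proof. by rewrite !mul2n ltn_Sdouble. Qed.

(* The coordinates of F^(2n) are numbered from 0; they are grouped in n
   consecutive pairs, the i-th one being (2i, 2i+1). *)
Definition ord_fst n (i : 'I_n) : 'I_(2 * n) := Ordinal (ord_fst_subproof i).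
Definition ord_snd n (i : 'I_n) : 'I_(2 * n) := Ordinal (ord_snd_subproof i).

Section OrthogonalGroups.
Variables (F : finFieldType) (delta : F).

Definition plus_form n (x : 'cV[F]_(2 * n)) : F :=
  \sum_(i < n) x (ord_fst i) 0 * x (ord_snd i) 0.

(* Hyperbolic on all pairs but the last one (i.+1 = n), where it is
   a ^+ 2 - delta * b ^+ 2. For n = 0 the form is zero, and `minus type' is
   meaningless. *)
Definition minus_form n (x : 'cV[F]_(2 * n)) : F :=
  \sum_(i < n)
    if i.+1 == n then x (ord_fst i) 0 ^+ 2 - delta * x (ord_snd i) 0 ^+ 2
    else x (ord_fst i) 0 * x (ord_snd i) 0.

Definition quad_form (s : sign) n : 'cV[F]_(2 * n) -> F :=
  match s with Plus => @plus_form n | Minus => @minus_form n end.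

(* As in O(2n, q), n is half the dimension of the space. *)
Definition Ogrp (s : sign) n : {set 'M[F]_(2 * n)} :=
  [set g in unitmx | [forall x, quad_form s (g *m x) == quad_form s x]].

Definition SOgrp (s : sign) n : {set 'M[F]_(2 * n)} :=
  [set g in Ogrp s n | \det g == 1].

End OrthogonalGroups.

Definition num_sqrt1 (F : finFieldType) n (X : {set 'M[F]_n}) : nat :=
  #|[set g in X | g *m g == 1%:M]|.

(* The product of the u i for i >= 1, as the limit of the partial products
   (meaningful when these converge). *)
Definition infprod1 (R : realType) (u : nat -> R) : R :=
  limn (fun n => \prod_(1 <= i < n.+1) u i).

(* Main.v *)
Require Import Defs.
From HB Require Import structures.
From mathcomp Require Import all_boot all_order all_algebra.
From mathcomp Require Import fingroup cyclic mxabelem.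
From mathcomp Require Import zify ring lra.

(** An element [g] with [g ^+ 2 = 1] is [1 - 2 E] for a self-adjoint idempotent
    [E], i.e. for the orthogonal projection onto a nondegenerate subspace, and
    [\det g = (-1) ^+ \rank E]; so we count nondegenerate subspaces [U] of odd
    dimension. Counting the pairs ([U], hyperbolic pair in [U]) in two ways
    gives a recursion for the number of [U] of dimension [2a + 1] in which only
    the number of singular vectors of the ambient space enters: in odd
    dimension [2a + 1] a nondegenerate form has exactly [q ^ 2a] of them. No
    orders of orthogonal groups and no Witt theorem are needed. With [x = 1/q],
    [phi_n = (1 - x^2) ... (1 - x^(2n))] and [N = n - 1] the result is
      i(O^eps(2n, q) \ SO^eps(2n, q)) / q^(n^2) = (1 - eps x^n) T_N,
      T_N = sum_a x^((N - 2a)^2) phi_N / (phi_a phi_(N-a)).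
    The finite triple product identity shows that
      J_N = sum_a x^((N - 2a)^2) phi_(2N) / (phi_(2a) phi_(2N-2a))
    is half of [P_N(1) + (-1)^N P_N(-1)], where
    [P_N(z) = prod_(i <= N) (1 + z x^(2i-1))^2]. The quotients of [phi] in the
    [a]-th terms of [T_N] and [J_N] differ by at most
    [2 (x^(2a) + x^(2N-2a))], and the weight [x^((N - 2a)^2)] makes each such
    contribution at most [4 x^N], so [T_N - J_N] tends to 0. *)

Set Implicit Arguments.
Unset Strict Implicit.
Unset Printing Implicit Defensive.

Import Order.TTheory GRing.Theory Num.Theory.

Local Open Scope ring_scope.

(** * Orthogonal projections over a finite field *)

Lemma mulmx_ext (F : pzRingType) m n (A B : 'M[F]_(m, n)) :
  (forall x : 'cV_n, A *m x = B *m x) -> A = B.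
Proof.
by move=> AB; apply/matrixP=> i j; have := AB (delta_mx j 0); rewrite -!colE =>
  /matrixP/(_ i 0); rewrite !mxE.
Qed.

(** Sylvester's identity: both sides are the determinant of the block matrix with rows [1, A] and
    [B, 1], factored in two ways into block triangular matrices. *)
Lemma det_1_sub_mul (F : comPzRingType) m n (A : 'M[F]_(m, n)) (B : 'M[F]_(n, m)) :
  \det (1%:M - A *m B) = \det (1%:M - B *m A).
Proof.
transitivity (\det (block_mx 1%:M A B 1%:M)).
  have -> : block_mx 1%:M A B 1%:M =
    block_mx 1%:M A 0 1%:M *m block_mx (1%:M - A *m B) 0 B 1%:M.
    by rewrite mulmx_block !mul1mx !mulmx1 ?mul0mx ?mulmx0 ?add0r ?addr0 subrK.
  by rewrite det_mulmx det_ublock det_lblock !det1 !mul1r mulr1.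
have -> : block_mx 1%:M A B 1%:M =
    block_mx 1%:M 0 B 1%:M *m block_mx 1%:M A 0 (1%:M - B *m A).
  by rewrite mulmx_block !mul1mx !mulmx1 ?mul0mx ?mulmx0 ?add0r ?addr0 addrC subrK.
by rewrite det_mulmx det_ublock det_lblock !det1 !mul1r.
Qed.

(** A rank factorisation [E = C *m R] of an idempotent has [R *m C = 1]; Sylvester's identity then
    moves the determinant to size [\rank E], where the matrix is [-1]. *)
Lemma det_1_sub_double_idempotent (F : fieldType) n (E : 'M[F]_n) :
  E *m E = E -> \det (1%:M - E *+ 2) = (-1) ^+ \rank E.
Proof.
move=> EE.
have /row_freeP[R'] := row_base_free E.
have /row_fullP[C'] := col_base_full E.
move: (mulmx_base E); move: (row_base E) (col_base E) => R C CR CC' RR'.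
have RC : R *m C = 1%:M.
  have: (C *m R) *m (C *m R) = C *m R by rewrite CR.
  move=> /(congr1 (fun X => C' *m X *m R')).
  by rewrite !mulmxA CC' !mul1mx -!mulmxA RR' !mulmx1.
rewrite -{1}CR -scaler_nat scalemxAl det_1_sub_mul -scalemxAr RC scaler_nat mulr2n.
by rewrite opprD addrA subrr sub0r -scaleN1r detZ det1 mulr1.
Qed.

(** By Lagrange in the additive group, [q] vanishes in [F]; if [2] vanished as well, an odd [q]
    would equal [1] there. *)
Lemma odd_card_two_neq0 (F : finFieldType) : odd #|F| -> (2%:R : F) != 0.
Proof.
have q0 : (#|F|%:R : F) = 0.
  by have := @expg_cardG F [set: F]%G (1%R : F) (in_setT _); rewrite cardsT.
move=> q_odd; apply: contra_eq_neq q0 => two0.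
rewrite -(odd_double_half #|F|) q_odd -mul2n natrD natrM two0 mul0r addr0.
exact: oner_neq0.
Qed.

(** The square [0] has one root and any other square at most two, so [q] is at most
    [1 + 2 (|S| - 1)] for the set [S] of squares. *)
Lemma card_squares (F : finFieldType) :
  (#|F| < 2 * #|[set x ^+ 2 | x : F]|)%N.
Proof.
set S := [set _ | x : F].
have S0 : 0 \in S by apply/imsetP; exists 0; rewrite ?expr0n.
rewrite -(sum1_card F) (partition_big (fun x : F => x ^+ 2) [in S]) /=; last first.
  by move=> x _; apply: imset_f.
rewrite (bigD1 0) //= (cardsD1 0 S) S0 mulnDr muln1 ltnS.
rewrite (eq_bigl (pred1 (0 : F))) => [|x]; last by rewrite expf_eq0.
rewrite big_pred1_eq leq_add2l mulnC -sum_nat_const.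
rewrite [leqRHS](eq_bigl (fun y => (y \in S) && (y != 0))) => [|y]; last first.
  by rewrite !inE andbC.
apply: leq_sum => y /andP[/imsetP[x0 _ ->] _].
rewrite sum1_card (leq_trans _ (card_size [:: x0; - x0])) //.
apply/subset_leq_card/subsetP => x; rewrite [x \in _](_ : _ = (x ^+ 2 == x0 ^+ 2)) //.
by rewrite eqf_sqr !inE.
Qed.

(** Pigeonhole: the values [a x^2] and the values [c - b y^2] each fill more than half of [F], so
    they share an element. *)
Lemma diag_form_surj (F : finFieldType) (a b c : F) : a != 0 -> b != 0 ->
  exists x y, a * x ^+ 2 + b * y ^+ 2 = c.
Proof.
move=> a0 b0; set S := [set x ^+ 2 | x : F].
pose A := [set a * s | s in S]; pose B := [set c - b * s | s in S].
have cA : #|A| = #|S| by apply: card_imset => s t /(mulfI a0).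
have cB : #|B| = #|S| by apply: card_imset => s t /addrI/oppr_inj/(mulfI b0).
have : A :&: B != set0.
  apply: contraTN (card_squares F) => /eqP AB0.
  by rewrite -leqNgt mul2n -addnn -{1}cA -cB -cardsUI AB0 cards0 addn0 max_card.
case/set0Pn => z /setIP[/imsetP[_ /imsetP[x _ ->] zx] /imsetP[_ /imsetP[y _ ->] zy]].
by exists x, y; rewrite -zx zy subrK.
Qed.

(** * Nondegenerate symmetric bilinear spaces and their orthogonal projections *)

Section QuadraticSpace.
Variables (F : finFieldType) (d : nat) (J : 'M[F]_d).
Local Notation q := #|F|.
Implicit Types (x y u v w : 'cV[F]_d) (E G : 'M[F]_d).

Definition bform x y : F := (x^T *m J *m y) 0 0.
Local Notation "<< x , y >>" := (bform x y) (at level 0, x, y at level 99).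

Hypothesis bformC : forall x y, <<x, y>> = <<y, x>>.
Hypothesis bform_nondegenerate : forall x, (forall y, <<x, y>> = 0) -> x = 0.
Hypothesis two_neq0 : (2%:R : F) != 0.

Lemma bformDr x y u : <<x, y + u>> = <<x, y>> + <<x, u>>.
Proof. by rewrite /bform mulmxDr mxE. Qed.
Lemma bformZr x a y : <<x, a *: y>> = a * <<x, y>>.
Proof. by rewrite /bform -scalemxAr mxE. Qed.
Lemma bform0r x : <<x, 0>> = 0.
Proof. by rewrite /bform mulmx0 mxE. Qed.
Lemma bformDl x y u : <<y + u, x>> = <<y, x>> + <<u, x>>.
Proof. by rewrite !(bformC _ x) bformDr. Qed.
Lemma bformZl x a y : <<a *: y, x>> = a * <<y, x>>.
Proof. by rewrite !(bformC _ x) bformZr. Qed.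
Lemma bform0l x : <<0, x>> = 0.
Proof. by rewrite bformC bform0r. Qed.
Definition bformE := (bformDr, bformZr, bformDl, bformZl).

(** Encodes the nondegenerate subspace [fixv E], of dimension [\rank E]; inclusions, complements and
    orthogonal sums become matrix identities. *)
Definition is_orthoproj E :=
  (E *m E == E) && [forall x, forall y, <<E *m x, y>> == <<x, E *m y>>].

Lemma orthoprojP E :
  reflect (E *m E = E /\ forall x y, <<E *m x, y>> = <<x, E *m y>>)
          (is_orthoproj E).
Proof.
apply: (iffP andP) => -[/eqP EE adj]; split => //.
  by move=> x y; apply/eqP/('forall_forallP adj).
by apply/'forall_forallP => x y; apply/eqP.
Qed.

Lemma orthoproj1 : is_orthoproj 1%:M.
Proof. by apply/orthoprojP; split=> [|x y]; rewrite !mul1mx. Qed.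

Definition fixv E : {set 'cV[F]_d} := [set x | E *m x == x].

Lemma fixvP E x : reflect (E *m x = x) (x \in fixv E).
Proof. by rewrite inE; apply: eqP. Qed.

Lemma card_fixv E : E *m E = E -> #|fixv E| = (q ^ \rank E)%N.
Proof.
move=> EE; rewrite -mxrank_tr -card_rowg -(card_imset _ (can_inj (@trmxK F d 1))).
apply: eq_card => y; apply/imsetP/idP => [[x /fixvP Ex ->]|].
  by rewrite inE; apply/submxP; exists x^T; rewrite -trmx_mul Ex.
rewrite inE => /submxP[z ->]; exists (E *m z^T); last by rewrite trmx_mul trmxK.
by apply/fixvP; rewrite mulmxA EE.
Qed.

(* For orthogonal projections, [E *m G = G] says that the image of [G] is
   contained in that of [E]. *)
Lemma orthoproj_subC E G : is_orthoproj E -> is_orthoproj G ->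
  E *m G = G -> G *m E = G.
Proof.
move=> /orthoprojP[_ adjE] /orthoprojP[_ adjG] EG.
apply: mulmx_ext => x; apply/eqP; rewrite -subr_eq0; apply/eqP.
apply: bform_nondegenerate => y.
have bformBl u v w : <<u - v, w>> = <<u, w>> - <<v, w>>.
  by rewrite -scaleN1r bformDl bformZl mulN1r.
by rewrite bformBl -mulmxA !(adjG, adjE) mulmxA EG subrr.
Qed.

(** [E - G] projects onto the orthogonal complement of the image of [G] inside the image of [E]. *)
Lemma orthoproj_sub E G : is_orthoproj E -> is_orthoproj G ->
  E *m G = G -> is_orthoproj (E - G).
Proof.
move=> pE pG EG; have GE := orthoproj_subC pE pG EG.
move/orthoprojP: pE => [EE adjE]; move/orthoprojP: pG => [GG adjG].
apply/orthoprojP; split=> [|x y].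
  by rewrite mulmxBl !mulmxBr EE EG GE GG subrr subr0.
by rewrite !mulmxBl -!scaleN1r !bformE adjE adjG.
Qed.

Lemma orthoproj_add E G : is_orthoproj E -> is_orthoproj G ->
  E *m G = 0 -> G *m E = 0 -> is_orthoproj (E + G).
Proof.
move=> /orthoprojP[EE adjE] /orthoprojP[GG adjG] EG GE.
apply/orthoprojP; split=> [|x y].
  by rewrite mulmxDl !mulmxDr EE EG GE GG addr0 add0r.
by rewrite !mulmxDl !bformE adjE adjG.
Qed.

Lemma mem_fixv_sub E G x : is_orthoproj E -> is_orthoproj G -> E *m G = G ->
  (x \in fixv (E - G)) = (x \in fixv E) && (G *m x == 0).
Proof.
move=> pE pG EG; have GE := orthoproj_subC pE pG EG.
move/orthoprojP: pE => [EE adjE]; move/orthoprojP: pG => [GG adjG].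
apply/fixvP/andP=> [xE|[/fixvP Ex /eqP Gx]]; last by rewrite mulmxBl Ex Gx subr0.
split; first by apply/fixvP; rewrite -xE mulmxA mulmxBr EE EG.
by rewrite -xE mulmxA mulmxBr GE GG subrr mul0mx.
Qed.

(** If the image contained only singular vectors, polarisation would give [2 <u, w> = 0] on it;
    since [<E x, y> = <E x, E y>], nondegeneracy would force [E = 0]. *)
Lemma orthoproj_neq0 E : is_orthoproj E -> (0 < \rank E)%N ->
  exists2 v, v \in fixv E & <<v, v>> != 0.
Proof.
move=> /orthoprojP[EE adjE] rE.
apply/exists_inP; apply: contraLR rE; rewrite negb_exists_in => /forall_inP isoE.
have {}isoE u : E *m u = u -> <<u, u>> = 0.
  by move=> Eu; apply/eqP; rewrite -[_ == _]negbK; apply: isoE; apply/fixvP.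
suff -> : E = 0 by rewrite mxrank0.
apply: mulmx_ext => x; rewrite mul0mx; apply: bform_nondegenerate => y.
rewrite -EE -mulmxA adjE; set u := E *m x; set w := E *m y.
have Eu : E *m u = u by rewrite mulmxA EE.
have Ew : E *m w = w by rewrite mulmxA EE.
have := isoE (u + w); rewrite mulmxDr Eu Ew => /(_ erefl).
rewrite !bformE !isoE // add0r addr0 (bformC w u) -mulr2n -mulr_natl.
by move/eqP; rewrite mulf_eq0 (negPf two_neq0) /= => /eqP.
Qed.

(** * Singular vectors and hyperbolic pairs *)

Definition singv E : {set 'cV[F]_d} := [set v in fixv E | <<v, v>> == 0].

Definition hyppairs E : {set 'cV[F]_d * 'cV[F]_d} :=
  [set p | [&& p.1 \in fixv E, p.2 \in fixv E, <<p.1, p.1>> == 0,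
               <<p.2, p.2>> == 0 & <<p.1, p.2>> == 1]].

Lemma hyppairsP E p :
  reflect [/\ E *m p.1 = p.1, E *m p.2 = p.2, <<p.1, p.1>> = 0,
             <<p.2, p.2>> = 0 & <<p.1, p.2>> = 1] (p \in hyppairs E).
Proof.
rewrite inE; apply: (iffP and5P) => -[/fixvP ? /fixvP ? /eqP ? /eqP ? /eqP ?] //.
Qed.

Definition subprojs E k : {set 'M[F]_d} :=
  [set G | [&& is_orthoproj G, E *m G == G & \rank G == k]].

Lemma subprojsP E k G :
  reflect [/\ is_orthoproj G, E *m G = G & \rank G = k] (G \in subprojs E k).
Proof.
rewrite in_set; apply: (iffP and3P) => -[? /eqP ? /eqP ?] //.
Qed.

(** For a hyperbolic pair, the orthogonal projection onto the plane spanned by [v] and [w]. *)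
Definition hypproj v w := (v *m w^T + w *m v^T) *m J.

Lemma hypprojE v w x : hypproj v w *m x = <<w, x>> *: v + <<v, x>> *: w.
Proof.
rewrite /hypproj -mulmxA mulmxDl -!mulmxA !(mulmxA _ J).
by rewrite [_^T *m J *m x]mx11_scalar [v^T *m J *m x]mx11_scalar !mul_mx_scalar.
Qed.

Lemma card_set_pair (S T : finType) (A : {set S}) (P : S -> pred T) :
  #|[set p | (p.1 \in A) && P p.1 p.2]| = (\sum_(u in A) #|[set b | P u b]|)%N.
Proof.
rewrite -sum1dep_card; under [RHS]eq_bigr => u _ do rewrite -sum1dep_card.
by rewrite pair_big_dep.
Qed.

Section HyperbolicPair.
Variables (E : 'M[F]_d) (p : 'cV[F]_d * 'cV[F]_d).
Hypotheses (pE : is_orthoproj E) (hp : p \in hyppairs E).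
Local Notation v := p.1.
Local Notation w := p.2.
Local Notation H := (hypproj v w).

Let Ev : E *m v = v. Proof. by case/hyppairsP: hp. Qed.
Let Ew : E *m w = w. Proof. by case/hyppairsP: hp. Qed.
Let vv : <<v, v>> = 0. Proof. by case/hyppairsP: hp. Qed.
Let ww : <<w, w>> = 0. Proof. by case/hyppairsP: hp. Qed.
Let vw : <<v, w>> = 1. Proof. by case/hyppairsP: hp. Qed.
Let wv : <<w, v>> = 1. Proof. by rewrite bformC vw. Qed.

Lemma hypproj_orthoproj : is_orthoproj H.
Proof.
apply/orthoprojP; split=> [|x y].
  apply: mulmx_ext => x; rewrite -mulmxA !hypprojE !bformE.
  by rewrite vv ww vw wv !mulr0 !mulr1 addr0 add0r.
by rewrite !hypprojE !bformE (bformC _ w) (bformC _ v); ring.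
Qed.

Lemma hypproj_sub : E *m H = H.
Proof.
by apply: mulmx_ext => x; rewrite -mulmxA !hypprojE mulmxDr -!scalemxAr Ev Ew.
Qed.

Lemma mem_fixv_hypproj x :
  (x \in fixv (E - H)) = [&& x \in fixv E, <<v, x>> == 0 & <<w, x>> == 0].
Proof.
rewrite mem_fixv_sub ?hypproj_orthoproj ?hypproj_sub //; congr (_ && _).
rewrite hypprojE; apply/eqP/andP => [Hx|[/eqP-> /eqP->]]; last by rewrite !scale0r addr0.
by split; [have := bform0r v | have := bform0r w];
  rewrite -Hx !bformE ?vv ?vw ?ww ?wv ?mulr0 ?mulr1 ?addr0 ?add0r => ->.
Qed.

(** Coordinates for the orthogonal decomposition of the image of [E] into that of [E - H] and the
    plane of [v] and [w]. Pairing with [w] and with [v] recovers the two scalars. *)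
Let split_v (t : 'cV[F]_d * (F * F)) := t.1 + (t.2.1 *: v + t.2.2 *: w).

Let split_v_inj : {in [set t | t.1 \in fixv (E - H)] &, injective split_v}.
Proof.
move=> [x [a b]] [y [a' b']]; rewrite !inE -!(rwP eqP) /= => Hx Hy.
move/fixvP: Hx; rewrite mem_fixv_hypproj => /and3P[_ /eqP vx /eqP wx].
move/fixvP: Hy; rewrite mem_fixv_hypproj => /and3P[_ /eqP vy /eqP wy].
rewrite /split_v /= => e.
have : <<v, x + (a *: v + b *: w)>> = <<v, y + (a' *: v + b' *: w)>> by rewrite e.
have : <<w, x + (a *: v + b *: w)>> = <<w, y + (a' *: v + b' *: w)>> by rewrite e.
rewrite !bformE vv vw ww wv vx vy wx wy !mulr0 !mulr1 !add0r !addr0 => ea eb.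
by move: e; rewrite ea eb => /addIr ->.
Qed.

Let split_v_im : [set split_v t | t in [set t | t.1 \in fixv (E - H)]] = fixv E.
Proof.
apply/setP => x; apply/imsetP/idP => [[[y [a b]]]|Ex].
  rewrite inE /= mem_fixv_hypproj => /andP[/fixvP Ey _] ->.
  by apply/fixvP; rewrite /split_v !mulmxDr -!scalemxAr Ey Ev Ew.
exists (x - H *m x, (<<w, x>>, <<v, x>>)).
  rewrite inE /= mem_fixv_sub ?hypproj_orthoproj ?hypproj_sub //.
  move/fixvP: Ex => Ex; apply/andP; split.
    by apply/fixvP; rewrite mulmxBr mulmxA hypproj_sub Ex.
  have /orthoprojP[HH _] := hypproj_orthoproj.
  by rewrite mulmxBr mulmxA HH subrr.
by rewrite /split_v /= -hypprojE subrK.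
Qed.

(** Dimensions are compared through cardinalities: the decomposition gives
    [q ^ \rank E = q ^ \rank (E - H) * q ^ 2]. *)
Lemma rank_hypproj : \rank E = (\rank (E - H)).+2.
Proof.
have q_gt1 : (1 < q)%N by apply: card_finNzRing_gt1.
apply/eqP; rewrite -(eqn_exp2l _ _ q_gt1).
have /orthoprojP[EE _] := pE.
have /orthoprojP[EH _] := orthoproj_sub pE hypproj_orthoproj hypproj_sub.
rewrite -card_fixv // -split_v_im card_in_imset //.
have -> : [set t | t.1 \in fixv (E - H)] = setX (fixv (E - H)) [set: F * F].
  by apply/setP=> t; rewrite !inE andbT.
by rewrite cardsX card_fixv // cardsT card_prod -(addn2 (\rank _)) expnD.
Qed.

Let split_v_form u a b : u \in fixv (E - H) ->
  <<split_v (u, (a, b)), split_v (u, (a, b))>> = <<u, u>> + 2%:R * a * b.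
Proof.
rewrite mem_fixv_hypproj => /and3P[_ /eqP vu /eqP wu].
by rewrite /split_v /= !bformE !(bformC u) vv vw ww wv vu wu; ring.
Qed.

(** The vector [u + a v + b w] is singular iff [<u, u> + 2 a b = 0]. Each [a != 0] admits exactly
    one [b]; [a = 0] admits all [q] values of [b] if [u] is singular and none otherwise. *)
Lemma card_singv_hypproj :
  #|singv E| = (q.-1 * q ^ \rank (E - H)%R + q * #|singv (E - H)%R|)%N.
Proof.
pose P u (ab : F * F) := <<u, u>> + 2%:R * ab.1 * ab.2 == 0.
pose D := [set t : 'cV[F]_d * (F * F) | (t.1 \in fixv (E - H)) && P t.1 t.2].
have inD t : (t \in D) = (t.1 \in fixv (E - H)) && P t.1 t.2 by rewrite in_set.
have sD : {subset D <= [set t | t.1 \in fixv (E - H)]}.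
  by move=> t; rewrite inD => /andP[tE _]; rewrite in_set.
have -> : singv E = [set split_v t | t in D].
  apply/setP => x; rewrite in_set -split_v_im; apply/andP/imsetP.
    case=> /imsetP[[u [a b]] ut ->] q0; exists (u, (a, b)) => //.
    have {}ut : u \in fixv (E - H) by move: ut; rewrite in_set.
    by move: q0; rewrite split_v_form // inD /= ut.
  case=> -[u [a b]] tD ->; split; first by rewrite imset_f // sD.
  by move: tD; rewrite inD /= => /andP[? ?]; rewrite split_v_form.
rewrite card_in_imset; last by move=> s t /sD ? /sD ?; apply: split_v_inj.
rewrite card_set_pair.
have Pcard u : #|[set ab | P u ab]| = (q.-1 + q * (<<u, u>> == 0%R))%N.
  pose P1 (a b : F) := <<u, u>> + 2%:R * a * b == 0.
  have -> : [set ab | P u ab] = [set ab | (ab.1 \in [set: F]) && P1 ab.1 ab.2].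
    by apply/setP=> ab; rewrite !inE.
  rewrite card_set_pair (bigD1 0) ?in_setT //= addnC; congr (_ + _)%N.
    under eq_bigr => a /andP[_ a0].
      have -> : [set b | P1 a b] = [set - <<u, u>> / (2%:R * a)].
        apply/setP=> b; rewrite !inE /P1 addrC addr_eq0.
        have c0 : 2%:R * a != 0 by rewrite mulf_neq0.
        by apply/eqP/eqP => [<-|->]; rewrite mulrC ?mulKf ?divfK.
      rewrite cards1; over.
    rewrite (eq_bigl (predC1 0)) => [|a]; last by rewrite !inE.
    by rewrite sum1_card cardC1.
  rewrite /P1; case: eqP => [->|nz]; rewrite ?muln1 ?muln0.
    rewrite -cardsT; apply: eq_card => b; rewrite !inE.
    by rewrite mulr0 mul0r addr0 eqxx.
  apply/eqP; rewrite cards_eq0; apply/eqP/setP=> b; rewrite !inE mulr0 mul0r addr0.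
  exact/eqP.
under eq_bigr => u _ do rewrite Pcard.
have /orthoprojP[EE _] := orthoproj_sub pE hypproj_orthoproj hypproj_sub.
rewrite big_split /= sum_nat_const card_fixv // mulnC; congr (_ + _)%N.
rewrite -big_distrr /=; congr (_ * _)%N.
by rewrite -sum1dep_card big_mkcondr /=; apply: eq_bigr => u _; case: eqP.
Qed.

End HyperbolicPair.

(** Fix [w1] in the image with [<v, w1> = 1]. Each [y] in the image is uniquely [w + a v + b w1]
    with [w] a partner of [v]: pairing with [v] forces [b = <v, y> - 1], and then singularity of [w]
    forces [a] to be half of [<z, z>] for [z = y - b w1]. *)
Lemma card_hyperbolic_partners E v : is_orthoproj E ->
  v \in singv E -> v != 0 ->
  (#|[set w in fixv E | (<<w, w>> == 0%R) && (<<v, w>> == 1%R)]| * q ^ 2 =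
   q ^ \rank E)%N.
Proof.
move=> /orthoprojP[EE adjE]; rewrite inE => /andP[/fixvP Ev /eqP vv] v0.
have [w1 Ew1 vw1] : exists2 w, E *m w = w & <<v, w>> = 1.
  have [y vy] : exists y, <<v, y>> != 0.
    apply/existsP; apply: contraNT v0 => /existsPn v0.
    by apply/eqP/bform_nondegenerate => y; apply/eqP; rewrite -[_ == _]negbK v0.
  exists (<<v, y>>^-1 *: (E *m y)); first by rewrite -scalemxAr mulmxA EE.
  by rewrite bformZr -adjE Ev mulVf.
set S := [set w in fixv E | _].
have SP w : reflect [/\ E *m w = w, <<w, w>> = 0 & <<v, w>> = 1] (w \in S).
  rewrite inE; apply: (iffP and3P) => -[/fixvP ? /eqP ? /eqP ?]; first by [].
  by split=> //; apply/eqP.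
pose f (t : 'cV[F]_d * (F * F)) := t.1 + (t.2.1 *: v + t.2.2 *: w1).
have -> : (q ^ 2 = #|[set: F * F]|)%N by rewrite cardsT card_prod.
rewrite -cardsX -card_fixv // -(card_in_imset (f := f)).
  congr #|pred_of_set _|; apply/setP=> y; apply/imsetP/fixvP.
    case=> -[w [a b]]; rewrite in_setX in_setT andbT => /SP[Ew _ _] ->.
    by rewrite /f /= !mulmxDr -!scalemxAr Ew Ev Ew1.
  move=> Ey; pose c := <<v, y>> - 1; pose y' := y - c *: w1.
  have vy' : <<v, y'>> = 1.
    by rewrite /y' -scaleNr !bformE vw1 mulr1 /c; ring.
  have Ey' : E *m y' = y' by rewrite mulmxBr -scalemxAr Ey Ew1.
  have -> : y = y' + c *: w1 by rewrite subrK.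
  move: y' vy' Ey' => z vz Ez; pose t := <<z, z>> / 2%:R.
  exists (z - t *: v, (t, c)); last by rewrite /f /= addrA subrK.
  rewrite in_setX in_setT andbT; apply/SP; split; rewrite /= -scaleNr.
  - by rewrite mulmxDr -scalemxAr Ez Ev.
  - by rewrite !bformE (bformC z v) vz vv /t; field.
  - by rewrite !bformE vv vz mulr0 addr0.
move=> [w [a b]] [w' [a' b']]; rewrite !in_setX !in_setT !andbT.
move=> /SP[_ ww vw] /SP[_ ww' vw'].
rewrite /f /= => e.
have : <<v, w + (a *: v + b *: w1)>> = <<v, w' + (a' *: v + b' *: w1)>> by rewrite e.
rewrite !bformE vv vw vw' vw1 !mulr1 !mulr0 !add0r => /addrI eb.
move: e; rewrite eb !addrA => /addIr e.
have : <<w + a *: v, w + a *: v>> = <<w' + a' *: v, w' + a' *: v>> by rewrite e.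
rewrite !bformE !(bformC _ v) vv vw vw' ww ww' !(mulr1, mulr0, add0r, addr0).
rewrite -!mulr2n -[a *+ 2]mulr_natl -[a' *+ 2]mulr_natl => /(mulfI two_neq0) ea.
by move: e; rewrite ea => /addIr ->.
Qed.

Lemma singv0 E : 0 \in singv E.
Proof. by rewrite !inE mulmx0 bform0r !eqxx. Qed.

Lemma card_hyppairs E : is_orthoproj E ->
  (#|hyppairs E| * q ^ 2 = #|singv E|.-1 * q ^ \rank E)%N.
Proof.
move=> pE.
pose P v w := [&& w \in fixv E, <<w, w>> == 0 & <<v, w>> == 1].
have -> : hyppairs E = [set p | (p.1 \in singv E) && P p.1 p.2].
  apply/setP=> p; rewrite !inE /P !inE.
  by case: (E *m p.1 == p.1); case: (E *m p.2 == p.2); case: (<<p.1, p.1>> == 0).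
(* The zero vector counts as singular but has no partner, hence the [.-1] in the statement. *)
rewrite card_set_pair (bigD1 0) ?singv0 //=.
have -> : [set w | P 0 w] = set0.
  by apply/setP=> w; rewrite !inE /P bform0l [0 == 1]eq_sym oner_eq0 !andbF.
rewrite cards0 add0n big_distrl /= (eq_bigr (fun=> (q ^ \rank E)%N)).
  rewrite (eq_bigl [in singv E :\ 0]) => [|v]; last by rewrite [RHS]inE in_set1 andbC.
  by rewrite sum_nat_const (cardsD1 0 (singv E)) singv0.
by move=> v /andP[vE v0]; rewrite -(card_hyperbolic_partners pE vE v0).
Qed.

Lemma hyppairsS E G p : E *m G = G -> p \in hyppairs G -> p \in hyppairs E.
Proof.
move=> EG /hyppairsP[Gv Gw vv ww vw]; apply/hyppairsP; split=> //.
  by rewrite -Gv mulmxA EG.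
by rewrite -Gw mulmxA EG.
Qed.

(** With [H] the plane of [p], the map [K] to [K + H] is a bijection onto the subspaces containing
    [p], with inverse [G] to [G - H]. *)
Lemma card_subprojs_hyppair E p k : is_orthoproj E -> p \in hyppairs E ->
  #|[set G in subprojs E k.+2 | p \in hyppairs G]| =
  #|subprojs (E - hypproj p.1 p.2) k|.
Proof.
move=> pE hp; set H := hypproj _ _.
have pH : is_orthoproj H by apply: hypproj_orthoproj hp.
have EH : E *m H = H by apply: hypproj_sub.
have /orthoprojP[HH _] := pH.
have HE := orthoproj_subC pE pH EH.
have /orthoprojP[EE _] := pE.
rewrite -(card_imset (subprojs (E - H) k) (addIr H)).
apply: eq_card => G; apply/idP/imsetP.
  rewrite in_set => /andP[/subprojsP[pG EG rG] hG].
  have pH' : is_orthoproj H by [].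
  have GH : G *m H = H by apply: hypproj_sub.
  have HG := orthoproj_subC pG pH GH.
  exists (G - H); last by rewrite subrK.
  apply/subprojsP; split; first exact: orthoproj_sub.
    by rewrite mulmxBl !mulmxBr EG EH HG HH subrr subr0.
  by apply/eqP; rewrite -2!eqSS -rank_hypproj // rG.
case=> K /subprojsP[pK EK rK] ->.
have EK' : E *m K = K by rewrite -EK mulmxA mulmxBr EE EH.
have HK : H *m K = 0 by rewrite -EK mulmxA mulmxBr HE HH subrr mul0mx.
have KH : K *m H = 0.
  rewrite -(orthoproj_subC (orthoproj_sub pE pH EH) pK EK).
  by rewrite -mulmxA mulmxBl EH HH subrr mulmx0.
have pKH := orthoproj_add pK pH KH HK.
have hKH : p \in hyppairs (K + H).
  have /hyppairsP[_ _ vv ww vw] := hp.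
  have wv : <<p.2, p.1>> = 1 by rewrite bformC.
  have Hv : H *m p.1 = p.1 by rewrite hypprojE wv vv scale1r scale0r addr0.
  have Hw : H *m p.2 = p.2 by rewrite hypprojE vw ww scale1r scale0r add0r.
  have fixH x : H *m x = x -> (K + H) *m x = x.
    by move=> Hx; rewrite mulmxDl -{1}Hx mulmxA KH mul0mx add0r.
  by apply/hyppairsP; split=> //; apply: fixH.
rewrite in_set hKH andbT; apply/subprojsP; split=> //; first by rewrite mulmxDr EK' EH.
by rewrite (rank_hypproj pKH hKH) addrK rK.
Qed.

(** Double counting of the pairs [(G, p)] with [p] a hyperbolic pair in [G]; this is the source of
    the recursion in [card_subprojs_odd]. *)
Lemma sum_card_hyppairs E k : is_orthoproj E ->
  (\sum_(G in subprojs E k.+2) #|hyppairs G| =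
   \sum_(p in hyppairs E) #|subprojs (E - hypproj p.1 p.2)%R k|)%N.
Proof.
move=> pE.
under eq_bigr => G _ do rewrite -sum1_card.
rewrite (exchange_big_dep [in hyppairs E]) /=; last first.
  by move=> G p /subprojsP[_ EG _]; apply: hyppairsS.
apply: eq_bigr => p hp; rewrite -card_subprojs_hyppair // sum1_card.
by apply: eq_card => G; rewrite in_set.
Qed.

(** * Nondegenerate lines, and singular vectors in odd dimension *)

Definition lineproj v := <<v, v>>^-1 *: (v *m v^T *m J).

Lemma lineprojE v x : lineproj v *m x = (<<v, x>> / <<v, v>>) *: v.
Proof.
rewrite /lineproj -scalemxAl -!mulmxA (mulmxA _ J).
by rewrite [_^T *m J *m x]mx11_scalar mul_mx_scalar scalerA mulrC.
Qed.

Lemma lineproj_orthoproj v : <<v, v>> != 0 -> is_orthoproj (lineproj v).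
Proof.
move=> v0; apply/orthoprojP; split=> [|x y].
  apply: mulmx_ext => x; rewrite -mulmxA !lineprojE bformZr.
  by rewrite mulfK.
by rewrite !lineprojE !bformE (bformC _ v); ring.
Qed.

Lemma rank_lineproj v : (\rank (lineproj v) <= 1)%N.
Proof.
rewrite (leq_trans (mxrankS (scalemx_sub _ (submx_refl _)))) // -mulmxA.
by rewrite (leq_trans (mxrankM_maxl _ _)) // rank_leq_col.
Qed.

Lemma lineproj_sub E v : E *m v = v -> E *m lineproj v = lineproj v.
Proof. by move=> Ev; rewrite -scalemxAr !mulmxA Ev. Qed.

(** Splitting off lines yields pairwise orthogonal nonsingular [v], [w], [u]. The binary form on
    [v], [w] takes the value [- <u, u>], so some [x v + y w + u] is singular; it is nonzero because
    its product with [u] is [<u, u>]. *)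
Lemma isotropic_exists E : is_orthoproj E -> (2 < \rank E)%N ->
  exists2 v, v \in singv E & v != 0.
Proof.
move=> pE rE.
have split_line G v : is_orthoproj G -> v \in fixv G -> <<v, v>> != 0 ->
    is_orthoproj (G - lineproj v) /\ (\rank G <= (\rank (G - lineproj v)%R).+1)%N.
  move=> pG /fixvP Gv v0; split.
    by rewrite orthoproj_sub ?lineproj_orthoproj ?lineproj_sub.
  rewrite -addn1 -{1}[G](subrK (lineproj v)) (leq_trans (mxrank_add _ _)) //.
  by rewrite leq_add2l rank_lineproj.
have perp G v x : is_orthoproj G -> v \in fixv G -> <<v, v>> != 0 ->
    x \in fixv (G - lineproj v) -> x \in fixv G /\ <<v, x>> = 0.
  move=> pG /fixvP Gv v0; rewrite mem_fixv_sub ?lineproj_orthoproj ?lineproj_sub //.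
  case/andP=> -> /eqP; rewrite lineprojE => /(congr1 (bform v)).
  by rewrite bformZr bform0r divfK.
have [|v Ev v0] := orthoproj_neq0 pE; first by lia.
have [pG rG] := split_line E v pE Ev v0; set G := E - _ in pG rG.
have [|w Gw w0] := orthoproj_neq0 pG; first by lia.
have [pK rK] := split_line G w pG Gw w0; set K := G - _ in pK rK.
have [|u Ku u0] := orthoproj_neq0 pK; first by lia.
have [Ew vw] := perp E v w pE Ev v0 Gw.
have [Gu wu] := perp G w u pG Gw w0 Ku.
have [Eu vu] := perp E v u pE Ev v0 Gu.
have [x [y xy]] := diag_form_surj (- <<u, u>>) v0 w0.
exists (x *: v + y *: w + u).
  rewrite inE; apply/andP; split.
    by apply/fixvP; rewrite !mulmxDr -!scalemxAr (fixvP _ _ Ev) (fixvP _ _ Ew) (fixvP _ _ Eu).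
  rewrite !bformE !(bformC u) (bformC w v) vw vu wu -[_ == 0]/(_ == _).
  by apply/eqP; rewrite -[RHS](subrr <<u, u>>) [RHS]addrC -xy; ring.
apply: contraNneq u0 => e0.
have : <<u, x *: v + y *: w + u>> = 0 by rewrite e0 bform0r.
by rewrite !bformE (bformC u v) (bformC u w) vu wu !mulr0 !add0r => ->.
Qed.

(** In rank 1 there is no hyperbolic pair, so the count of such pairs leaves only the zero vector.
    Splitting off a hyperbolic plane then gives [(q - 1) q^(2a+1) + q q^(2a) = q^(2a+2)]. *)
Lemma card_singv_odd E a : is_orthoproj E -> \rank E = a.*2.+1 ->
  #|singv E| = (q ^ a.*2)%N.
Proof.
have q_gt1 : (1 < q)%N by apply: card_finNzRing_gt1.
elim: a E => [|a IHa] E pE rE.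
  have := card_hyppairs pE; rewrite rE.
  have -> : hyppairs E = set0.
    apply/setP=> p; rewrite in_set0; apply/negP => hp.
    by have := rank_hypproj pE hp; rewrite rE.
  have singv_gt0 : (0 < #|singv E|)%N by apply/card_gt0P; exists 0; apply: singv0.
  rewrite cards0 mul0n expn1 => /esym/eqP; rewrite muln_eq0 => /orP[/eqP|/eqP]; last by lia.
  by rewrite expn0; lia.
have [|v vE v0] := isotropic_exists pE; first by rewrite rE; lia.
have [w vw] : exists w, (v, w) \in hyppairs E.
  have := card_hyperbolic_partners pE vE v0.
  have [->|[w] + _] := set_0Vmem [set w in fixv E | (<<w, w>> == 0) && (<<v, w>> == 1)].
    by rewrite cards0 mul0n => /esym/eqP; rewrite expn_eq0; lia.
  rewrite inE => /and3P[/fixvP Ew /eqP ww /eqP vw]; exists w; apply/hyppairsP.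
  by move: vE; rewrite inE => /andP[/fixvP ? /eqP ?]; split.
have rH := rank_hypproj pE vw; rewrite (card_singv_hypproj pE vw) IHa.
- have -> : \rank (E - hypproj v w) = a.*2.+1 by rewrite rE in rH; case: rH.
  by rewrite doubleS !expnS -mulSnr prednK // ltnW.
- by apply: orthoproj_sub => //; [apply: hypproj_orthoproj vw | apply: hypproj_sub vw].
- by rewrite rE in rH; case: rH.
Qed.

(** A nonsingular vector spans a nondegenerate line, and each such line consists of [0] and [q - 1]
    nonsingular vectors. This is the base case of the recursion. *)
Lemma card_subprojs1 E : is_orthoproj E ->
  (#|subprojs E 1| * q.-1 + #|singv E| = q ^ \rank E)%N.
Proof.
move=> pE; have /orthoprojP[EE _] := pE.
have q_gt1 : (1 < q)%N by apply: card_finNzRing_gt1.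
rewrite -card_fixv // -(cardsID (singv E) (fixv E)) addnC; congr (_ + _)%N.
  by congr #|pred_of_set _|; apply/setP=> x; rewrite !inE; case: (_ *m _ == _).
rewrite -(sum1_card [in fixv E :\: singv E]).
rewrite (partition_big lineproj [in subprojs E 1]) /=; last first.
  move=> v; rewrite !inE => /andP[+ Ev]; rewrite Ev /= => v0.
  rewrite lineproj_orthoproj // lineproj_sub ?(eqP Ev) // eqxx /=.
  rewrite eqn_leq rank_lineproj lt0n mxrank_eq0; apply/eqP => l0.
  have := lineprojE v v; rewrite l0 mul0mx.
  by rewrite divff // scale1r => v_eq0; rewrite -v_eq0 bform0r eqxx in v0.
rewrite -sum_nat_const; apply: eq_bigr => G /subprojsP[pG EG rG].
have /orthoprojP[GG _] := pG.
have cG : #|fixv G| = q by rewrite card_fixv // rG expn1.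
have sG : #|singv G| = 1%N by rewrite (card_singv_odd (a := 0)).
have -> : q.-1 = #|fixv G :\: singv G|.
  rewrite -[X in X.-1]cG -(cardsID (singv G) (fixv G)).
  have -> : fixv G :&: singv G = singv G.
    by apply/setP=> x; rewrite !inE; case: (_ *m _ == _).
  by rewrite sG.
rewrite sum1_card; apply: eq_card => v; rewrite [RHS]inE !in_setD ![_ \in singv _]in_set.
apply/andP/andP => [[nv vG]|[+ /eqP lG]].
  have v0 : <<v, v>> != 0 by move: nv; rewrite vG.
  split; last first.
    (* The [q] multiples of [v] lie in [fixv G], which also has [q] elements, so they exhaust it. *)
    have lv x : exists c, G *m x = c *: v.
      have line_inj : injective (fun c : F => c *: v).
        move=> a b /= ab; apply: (mulIf v0).
        by rewrite -!bformZr ab.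
      have : [set c *: v | c : F] == fixv G.
        rewrite eqEcard cG card_imset // leqnn andbT; apply/subsetP => _ /imsetP[c _ ->].
        by apply/fixvP; rewrite -scalemxAr; move/fixvP: vG => ->.
      move/eqP => lineG; have : G *m x \in fixv G by apply/fixvP; rewrite mulmxA GG.
      by rewrite -lineG => /imsetP[c _ ->]; exists c.
    have lGG : lineproj v *m G = lineproj v.
      apply: orthoproj_subC; rewrite ?lineproj_orthoproj //.
      by apply: lineproj_sub; apply/fixvP.
    apply/eqP/mulmx_ext => x; rewrite -lGG -mulmxA; have [c ->] := lv x.
    by rewrite lineprojE bformZr mulfK.
  have /fixvP Gv := vG; have Ev : v \in fixv E by apply/fixvP; rewrite -Gv mulmxA EG.
  by rewrite Ev v0.
move=> /andP[nv vE]; rewrite vE /= in nv.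
have vG : v \in fixv G by apply/fixvP; rewrite -lG lineprojE divff // scale1r.
by rewrite vG.
Qed.

End QuadraticSpace.

(** * The number of nondegenerate subspaces of odd dimension *)

Definition phi (R : fieldType) (x : R) n := \prod_(i < n) (1 - x ^+ (i.+1).*2).

Lemma phi0 (R : fieldType) (x : R) : phi x 0 = 1.
Proof. by rewrite /phi big_ord0. Qed.

Lemma phiS (R : fieldType) (x : R) n : phi x n.+1 = phi x n * (1 - x ^+ (n.+1).*2).
Proof. by rewrite /phi big_ord_recr. Qed.

Lemma phi_neq0 (R : realFieldType) (x : R) n : 0 <= x < 1 -> phi x n != 0.
Proof.
move=> x01; apply/prodf_neq0 => i _; rewrite gt_eqF // subr_gt0.
by rewrite exprn_ilt1 //; lra.
Qed.

Section Counting.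
Variables (F : finFieldType) (d : nat) (J : 'M[F]_d).
Local Notation q := #|F|.
Hypothesis bformC : forall x y, bform J x y = bform J y x.
Hypothesis bform_nondegenerate : forall x, (forall y, bform J x y = 0) -> x = 0.
Hypothesis two_neq0 : (2%:R : F) != 0.

(** Induction on [a] for all [E]; the type [eps] enters only through the number of singular vectors.
    If [N] is the number wanted for [a + 1], double counting gives [N (Q^(2a+2) - 1) Q^(2a+1)] on
    one side and, on the other, [#|hyppairs J E|] times the number of subspaces of dimension
    [2a + 1] in the complement of a hyperbolic plane. *)
Lemma card_subprojs_odd (R : realFieldType) (eps : R) a b (E : 'M[F]_d) :
  let Q : R := q%:R in let n := (a + b).+1 in
  eps ^+ 2 = 1 -> is_orthoproj J E -> \rank E = n.*2 ->
  Q * #|singv J E|%:R = Q ^+ n.*2 + eps * Q ^+ n * (Q - 1) ->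
  #|subprojs J E a.*2.+1|%:R =
  Q ^+ ((a + b).*2.+1 + 4 * (a * b)) * (1 - eps / Q ^+ n) *
  (phi Q^-1 (a + b) / (phi Q^-1 a * phi Q^-1 b)).
Proof.
move=> Q; elim: a E => [|a IHa] E n eps2 pE rE sE.
  have q_gt1 : (1 < q)%N by apply: card_finNzRing_gt1.
  have Q1 : 1 < Q by rewrite ltr1n.
  have Q0 : 0 < Q by lra.
  have := card_subprojs1 bformC bform_nondegenerate two_neq0 pE.
  move=> /(congr1 (fun k : nat => k%:R : R)).
  rewrite natrD natrM -subn1 natrB ?(ltnW q_gt1) // natrX rE.
  rewrite phi0 mul1r divff ?mulr1 ?phi_neq0 ?invr_ge0 ?invf_lt1 ?(ltW Q0) //.
  rewrite mul0n muln0 addn0 add0n /n add0n doubleS !exprS -muln2 exprM -/Q in sE *.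
  have B0 : Q ^+ b != 0 by rewrite expf_neq0 // gt_eqF.
  move: (Q ^+ b) B0 sE => B B0 sE.
  have {sE} -> : #|singv J E|%:R = Q * B ^+ 2 + eps * B * (Q - 1).
    by apply: (mulfI (lt0r_neq0 Q0)); rewrite sE; ring.
  move=> e; have Q10 : Q - 1 != 0 by rewrite subr_eq0 gt_eqF.
  apply: (mulIf Q10); rewrite (canRL (addrK _) e).
  by field; rewrite B0 gt_eqF.
have q_gt1 : (1 < q)%N by apply: card_finNzRing_gt1.
have Q1 : 1 < Q by rewrite ltr1n.
have Q0 : 0 < Q by lra.
have := sum_card_hyppairs bformC bform_nondegenerate a.*2.+1 pE.
(* Here the dimension [2a + 3] is odd, so the number of hyperbolic pairs is the same for every
   [G]. *)
have hG G : G \in subprojs J E a.*2.+3 ->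
  (#|hyppairs J G|%:R : R) = (Q ^+ (a.+1).*2 - 1) * Q ^+ a.*2.+1.
  case/subprojsP => pG EG rG.
  have := card_hyppairs bformC bform_nondegenerate two_neq0 pG.
  rewrite (card_singv_odd bformC bform_nondegenerate two_neq0 pG (a := a.+1)) //.
  move=> /(congr1 (fun k : nat => k%:R : R)); rewrite !natrM -subn1 rG natrB; last first.
    by rewrite expn_gt0 ltnW.
  rewrite !natrX -/Q => e; apply: (mulIf (expf_neq0 2 (lt0r_neq0 Q0))).
  by rewrite e -[a.*2.+3]addn2 exprD mulrA.
move=> /(congr1 (fun k : nat => k%:R : R)); rewrite !natr_sum.
rewrite (eq_bigr _ hG) big_const iter_addr_0.
pose n' := (a + b).+1.
have nE : n = n'.+1 by [].
(* Removing a hyperbolic plane lowers [n] by one and keeps [eps]: [card_singv_hypproj] transfers the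
   assumed number of singular vectors to the complement. *)
have hp p : p \in hyppairs J E ->
  (#|subprojs J (E - hypproj J p.1 p.2) a.*2.+1|%:R : R) =
  Q ^+ ((a + b).*2.+1 + 4 * (a * b)) * (1 - eps / Q ^+ n') *
    (phi Q^-1 (a + b) / (phi Q^-1 a * phi Q^-1 b)).
  move=> hp; have rH := rank_hypproj bformC bform_nondegenerate pE hp.
  have rH' : \rank (E - hypproj J p.1 p.2) = n'.*2.
    by rewrite rE nE doubleS in rH; case: rH.
  apply: IHa => //.
    apply: (orthoproj_sub bformC bform_nondegenerate) => //.
      exact: (hypproj_orthoproj bformC hp).
    exact: (hypproj_sub hp).
  have := card_singv_hypproj bformC bform_nondegenerate two_neq0 pE hp.
  move=> /(congr1 (fun k : nat => k%:R : R)).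
  rewrite natrD !natrM -subn1 natrB ?(ltnW q_gt1) // natrX rH' -/Q => e.
  move: sE; rewrite e nE -!muln2 !exprM !(exprS _ n').
  move: (Q ^+ n') #|singv _ _|%:R => u z ze.
  have : Q * (Q * z - u ^+ 2 - eps * u * (Q - 1)) = 0.
    have -> : Q * (Q * z - u ^+ 2 - eps * u * (Q - 1)) =
      Q * ((Q - 1) * u ^+ 2 + Q * z) - Q * u * (Q * u) - eps * (Q * u) * (Q - 1).
      by ring.
    by rewrite ze; ring.
  by move/eqP; rewrite mulf_eq0 gt_eqF //= -addrA -opprD subr_eq0 => /eqP.
rewrite (eq_bigr _ hp) big_const iter_addr_0.
have := card_hyppairs bformC bform_nondegenerate two_neq0 pE.
move=> /(congr1 (fun k : nat => k%:R : R)); rewrite !natrM -subn1 rE natrB; last first.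
  by apply/card_gt0P; exists 0; apply: singv0.
rewrite !natrX -/Q => hE.
move: sE hE; rewrite nE -!(muln2 n'.+1) !(exprM _ n'.+1) !(exprS _ n').
rewrite (_ : (a.+1 + b).*2.+1 + 4 * (a.+1 * b) =
  (a + b).*2.+1 + 4 * (a * b) + 2 + 4 * b)%N; last by lia.
have -> : phi Q^-1 (a.+1 + b) = phi Q^-1 (a + b) * (1 - (Q ^+ n')^-1 ^+ 2).
  by rewrite addSn phiS -muln2 exprM !exprVn.
rewrite (phiS _ a).
move=> sE hE e; rewrite -mulr_natr -[RHS]mulr_natr in e.
have dbl k : Q ^+ k.*2 = (Q ^+ k) ^+ 2 by rewrite -muln2 exprM.
have QA1 : (Q * Q ^+ a) ^+ 2 - 1 != 0.
  by rewrite -exprS -dbl subr_eq0 gt_eqF // exprn_egt1.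
have phinz k : phi Q^-1 k != 0.
  by rewrite phi_neq0 // invr_ge0 invf_lt1 // ltW.
move: e sE hE (phinz (a + b)%N) (phinz a) (phinz b) QA1.
have := expf_neq0 a (lt0r_neq0 Q0); have := expf_neq0 b (lt0r_neq0 Q0).
have := expf_neq0 (4 * (a * b))%N (lt0r_neq0 Q0).
(* Once every power of [Q] is a monomial in [Q], [Q^a], [Q^b] and [Q^(4ab)], and these are
   generalised, the recursion is a rational identity. *)
have E1 : Q ^+ ((a + b).*2.+1 + 4 * (a * b)) =
    Q * (Q ^+ a * Q ^+ b) ^+ 2 * Q ^+ (4 * (a * b)).
  by rewrite exprD exprS dbl exprD.
have E2 : Q ^+ (4 * b) = (Q ^+ b) ^+ 4 by rewrite mulnC exprM.
rewrite (exprD _ _ (4 * b)) (exprD _ _ 2) E1 E2 !exprVn /n'.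
rewrite !(exprS Q a.*2, exprS Q (a + b)%N) !dbl.
rewrite (exprS Q a) (exprD Q a b).
move: (Q ^+ (4 * (a * b))) (Q ^+ a) (Q ^+ b).
move: (phi _ (a + b)) (phi _ a) (phi _ b) #|_|%:R #|_|%:R #|_|%:R.
move=> p pa pb z h N M A B M0 B0 A0 eN eZ eh p0 pa0 pb0 QA1.
have Qn0 : Q != 0 by rewrite gt_eqF.
have {}eZ : z = Q * (Q * (A * B)) ^+ 2 + eps * (Q * (A * B)) * (Q - 1).
  by apply: (mulfI Qn0); rewrite eZ; ring.
have {}eh : h = (z - 1) * (Q * (A * B)) ^+ 2.
  by apply: (mulIf (mulf_neq0 Qn0 Qn0)); rewrite eh; ring.
have D0 : ((Q * A) ^+ 2 - 1) * (Q * A ^+ 2) != 0 by rewrite !mulf_neq0 ?expf_neq0.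
apply: (mulfI D0); rewrite eN eh eZ.
move/eqP: eps2; rewrite sqrf_eq1 => /orP[] /eqP ->; field;
  by apply/and5P; split=> //; apply/andP.
Qed.

Lemma card_odd_orthoprojs m : d = m.+1.*2 ->
  #|[set E | is_orthoproj J E & odd (\rank E)]| =
  (\sum_(a < m.+1) #|subprojs J 1%:M a.*2.+1|)%N.
Proof.
move=> dm; rewrite -sum1dep_card.
rewrite (partition_big (fun E : 'M_d => inord (\rank E)./2 : 'I_m.+1) predT) //=.
apply: eq_bigr => a _; rewrite sum1dep_card; apply: eq_card => E.
have rE : (\rank E <= m.+1.*2)%N by rewrite -dm rank_leq_row.
rewrite in_set; apply/andP/subprojsP => [[/andP[pE oE] /eqP <-]|[pE _ r]].
  (* An odd rank differs from [d = 2 (m + 1)], so its half is at most [m] and [inord] does not fall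
     back on its default. *)
  have rE2 : ((\rank E)./2 < m.+1)%N.
    rewrite ltn_half_double ltn_neqAle rE andbT.
    by apply: contraTneq oE => ->; rewrite odd_double.
  by split; rewrite ?mul1mx ?inordK // -[LHS]odd_double_half oE.
rewrite pE r /= odd_double; split=> //.
by apply/eqP/val_inj; rewrite /= uphalf_double inordK.
Qed.

(** The bijection sends [E] to [1 - 2 E], with inverse [g] to [(1 - g) / 2]; the determinant
    [(-1)^rank] differs from [1] exactly for odd rank. *)
Lemma card_improper_involutions :
  #|[set g : 'M[F]_d | [&& g *m g == 1%:M,
      [forall x, bform J (g *m x) (g *m x) == bform J x x] & \det g != 1]]| =
  #|[set E | is_orthoproj J E & odd (\rank E)]|.
Proof.
have neq11 : (-1 : F) != 1.
  by rewrite -subr_eq0 -opprD oppr_eq0 -(natrD _ 1 1).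
have det_refl (E : 'M[F]_d) : E *m E = E ->
    (\det (1%:M - E *+ 2) != 1) = odd (\rank E).
  move=> EE; have -> : \det (1%:M - E *+ 2) = (-1 : F) ^+ odd (\rank E).
    by rewrite signr_odd; apply: det_1_sub_double_idempotent.
  by case: (odd (\rank E)); [rewrite expr1 neq11 | rewrite expr0 eqxx].
pose f (E : 'M[F]_d) := 1%:M - E *+ 2.
have f_inj : injective f.
  move=> E G /addrI/oppr_inj; rewrite -!scaler_nat.
  exact: scalerI.
rewrite -[RHS](card_imset _ f_inj); apply: eq_card => g; apply/idP/imsetP.
  rewrite in_set => /and3P[/eqP gg /forallP isog dg].
  pose E := 2%:R^-1 *: (1%:M - g).
  have gE : g = f E by rewrite /f -scaler_nat scalerA divff // scale1r opprB addrC subrK.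
  have EE : E *m E = E.
    rewrite /E -scalemxAl -scalemxAr mulmxBl !mulmxBr gg !mulmx1 !mul1mx opprB.
    rewrite -mulr2n -(scaler_nat 2) 2!scalerA -mulrA mulVf // mulr1.
    by [].
  exists E => //; rewrite in_set -det_refl // -/(f E) -gE dg andbT.
  apply/orthoprojP; split=> // x y.
  (* Polarisation: [2 <u, w> = <u + w, u + w> - <u, u> - <w, w>], and [2] is invertible. *)
  have polar u w : bform J (g *m u) (g *m w) = bform J u w.
    have := eqP (isog (u + w)); rewrite mulmxDr !bformDl // !bformDr.
    rewrite !(eqP (isog _)) !(bformC _ (_ *m u)) (bformC w u).
    move=> e; apply: (mulfI two_neq0).
    have two_x (t a b : F) : 2%:R * t = a + t + (t + b) - a - b by ring.
    by rewrite (two_x _ (bform J u u) (bform J w w)) e -two_x.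
  (* For an involution, being an isometry amounts to being self-adjoint:
     [<g u, w> = <g u, g (g w)> = <u, g w>]. *)
  have adj u w : bform J (g *m u) w = bform J u (g *m w).
    by rewrite -polar mulmxA gg mul1mx.
  by rewrite /E -!scalemxAl !mulmxBl !mul1mx -!scaleN1r !bformE // adj.
case=> E; rewrite in_set => /andP[/orthoprojP[EE adj] oE] ->.
rewrite in_set det_refl // oE andbT; apply/andP; split.
  rewrite /f -scaler_nat; apply/eqP; rewrite mulmxBl !mulmxBr !mul1mx !mulmx1.
  rewrite -scalemxAl -scalemxAr EE; apply/matrixP => i j; rewrite !mxE; ring.
apply/forallP=> x; apply/eqP.
rewrite /f -scaler_nat mulmxBl mul1mx -scalemxAl -scaleNr !bformE // !adj.
rewrite !mulmxA EE; ring.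
Qed.

End Counting.

(** * The standard forms *)

Lemma ord_fst_inj n : injective (@ord_fst n).
Proof. by move=> i j [] /eqP; rewrite eqn_pmul2l // => /eqP/val_inj. Qed.

Lemma ord_snd_inj n : injective (@ord_snd n).
Proof. by move=> i j [] /eqP; rewrite eqn_pmul2l // => /eqP/val_inj. Qed.

Lemma ord_fst_neq_snd n (i j : 'I_n) : (ord_fst i == ord_snd j) = false.
Proof. by apply/eqP => /(congr1 val) /=; lia. Qed.

Lemma ord_fst_snd_cover n (j : 'I_(2 * n)) :
  exists i : 'I_n, j = ord_fst i \/ j = ord_snd i.
Proof.
have jn : (j./2 < n)%N by rewrite ltn_half_double -mul2n.
exists (Ordinal jn); have := odd_double_half j.
case: (odd j) => e; [right | left]; apply/val_inj => /=; lia.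
Qed.

Section StandardForm.
Variables (F : finFieldType) (delta : F) (s : sign) (n : nat).
Hypothesis delta_nonsquare : ~ (exists x : F, x ^+ 2 = delta).
Hypothesis two_neq0 : (2%:R : F) != 0.

Definition elliptic_pair (i : 'I_n) := if s is Minus then i.+1 == n else false.

(** Gram matrix of the polar form, so [<x, x>] is twice the quadratic form; this explains the factor
    [2] on the elliptic pair. *)
Definition gram : 'M[F]_(2 * n) :=
  \sum_(i < n)
    let f := delta_mx (ord_fst i) 0 : 'cV_(2 * n) in
    let g := delta_mx (ord_snd i) 0 : 'cV_(2 * n) in
    if elliptic_pair i then 2%:R *: (f *m f^T - delta *: (g *m g^T))
    else f *m g^T + g *m f^T.

Lemma bform_delta_mx (x y : 'cV[F]_(2 * n)) j k :
  bform (delta_mx j (0 : 'I_1) *m (delta_mx k (0 : 'I_1))^T) x y = x j 0 * y k 0.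
Proof.
rewrite /bform !mulmxA -colE trmx_delta -mulmxA -rowE mxE big_ord1.
by rewrite !mxE.
Qed.

Lemma bform_gram x y : bform gram x y = \sum_(i < n)
  if elliptic_pair i then
    2%:R * (x (ord_fst i) 0 * y (ord_fst i) 0 -
            delta * (x (ord_snd i) 0 * y (ord_snd i) 0))
  else x (ord_fst i) 0 * y (ord_snd i) 0 + x (ord_snd i) 0 * y (ord_fst i) 0.
Proof.
rewrite [LHS]/bform mulmx_sumr mulmx_suml summxE; apply: eq_bigr => i _ /=.
have bD (A B : 'M[F]_(2 * n)) : bform (A + B) x y = bform A x y + bform B x y.
  by rewrite /bform mulmxDr mulmxDl mxE.
have bZ a (A : 'M[F]_(2 * n)) : bform (a *: A) x y = a * bform A x y.
  by rewrite /bform -scalemxAr -scalemxAl mxE.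
rewrite -/(bform _ x y); case: ifP => _.
  by rewrite -scaleNr !(bD, bZ) !bform_delta_mx mulNr.
by rewrite bD !bform_delta_mx.
Qed.

Lemma bform_gramC x y : bform gram x y = bform gram y x.
Proof. by rewrite !bform_gram; apply: eq_bigr => i _; case: ifP => _; ring. Qed.

Lemma bform_gram_diag x : bform gram x x = 2%:R * quad_form delta s x.
Proof.
rewrite bform_gram /elliptic_pair; case: s => /=.
  rewrite /plus_form big_distrr; apply: eq_bigr => i _ /=; ring.
rewrite /minus_form big_distrr; apply: eq_bigr => i _ /=.
by case: ifP => _; ring.
Qed.

Lemma bform_gram_fst x i : bform gram x (delta_mx (ord_fst i) 0) =
  if elliptic_pair i then 2%:R * x (ord_fst i) 0 else x (ord_snd i) 0.
Proof.
rewrite bform_gram (bigD1 i) //= big1 ?addr0 => [|j ji].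
  by rewrite !mxE !eqxx (eq_sym (ord_snd _)) ord_fst_neq_snd /=; case: ifP => _; ring.
rewrite !mxE (inj_eq (@ord_fst_inj n)) (eq_sym (ord_snd _)) ord_fst_neq_snd.
by rewrite (negPf ji) /=; case: ifP => _; ring.
Qed.

Lemma bform_gram_snd x i : bform gram x (delta_mx (ord_snd i) 0) =
  if elliptic_pair i then - 2%:R * delta * x (ord_snd i) 0 else x (ord_fst i) 0.
Proof.
rewrite bform_gram (bigD1 i) //= big1 ?addr0 => [|j ji].
  by rewrite !mxE !eqxx ord_fst_neq_snd /=; case: ifP => _; ring.
rewrite !mxE (inj_eq (@ord_snd_inj n)) ord_fst_neq_snd.
by rewrite (negPf ji) /=; case: ifP => _; ring.
Qed.

Lemma delta_neq0 : delta != 0.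
Proof. by apply/eqP => d0; apply: delta_nonsquare; exists 0; rewrite d0 expr0n. Qed.

Lemma coord_eq0 (x : 'cV[F]_(2 * n)) :
  (forall i, x (ord_fst i) 0 = 0) -> (forall i, x (ord_snd i) 0 = 0) -> x = 0.
Proof.
move=> xf xs; apply/colP=> j; rewrite mxE.
by have [i [->|->]] := ord_fst_snd_cover j.
Qed.

Lemma bform_gram_nondegenerate x : (forall y, bform gram x y = 0) -> x = 0.
Proof.
move=> x0; apply: coord_eq0 => i.
  have := x0 (delta_mx (ord_fst i) 0); have := x0 (delta_mx (ord_snd i) 0).
  rewrite bform_gram_fst bform_gram_snd; case: ifP => // _ _ /eqP.
  by rewrite mulf_eq0 (negPf two_neq0) /= => /eqP.
have := x0 (delta_mx (ord_fst i) 0); have := x0 (delta_mx (ord_snd i) 0).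
rewrite bform_gram_fst bform_gram_snd; case: ifP => // _ /eqP.
by rewrite !mulf_eq0 oppr_eq0 (negPf two_neq0) (negPf delta_neq0) /= => /eqP.
Qed.

Lemma improper_involutions :
  [set g in Ogrp delta s n :\: SOgrp delta s n | g *m g == 1%:M] =
  [set g | [&& g *m g == 1%:M,
     [forall x, bform gram (g *m x) (g *m x) == bform gram x x] & \det g != 1]].
Proof.
apply/setP => g; rewrite !inE.
have -> : [forall x, bform gram (g *m x) (g *m x) == bform gram x x] =
          [forall x, quad_form delta s (g *m x) == quad_form delta s x].
  by apply: eq_forallb => x; rewrite !bform_gram_diag (inj_eq (mulfI two_neq0)).
case: (g *m g =P 1%:M) => [gg|_]; last by rewrite !andbF.
have -> : g \in unitmx by have [] := mulmx1_unit gg.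
by rewrite andbT /=; case: [forall x, _]; rewrite ?andbF ?andbT.
Qed.

(* [E] projects onto the orthogonal complement of the hyperbolic planes spanned
   by the first [r] pairs of coordinates. *)
Lemma split_hyperbolic_planes r :
  (r <= n)%N -> (forall i : 'I_n, (i < r)%N -> ~~ elliptic_pair i) ->
  exists E, [/\ is_orthoproj gram E, \rank E = (n - r).*2,
    (forall x, (x \in fixv E) =
       [forall i : 'I_n, (i < r)%N ==>
          (x (ord_fst i) 0 == 0) && (x (ord_snd i) 0 == 0)]) &
    (#|F| * #|singv gram 1%:M| + #|F| ^ r * #|F| ^ (n - r).*2 =
     #|F| ^ n.*2 + #|F| ^ r.+1 * #|singv gram E|)%N].
Proof.
elim: r => [|r IHr] rn hyp.
  exists 1%:M; split.
  - exact: orthoproj1.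
  - by rewrite mxrank1 subn0 mul2n.
  - move=> x; rewrite inE mul1mx eqxx; apply/esym/forallP => i.
    by rewrite ltn0.
  - by rewrite subn0 mul1n expn1 addnC.
have [i ir|E [pE rE fE cE]] := IHr (ltnW rn); first by apply: hyp; rewrite ltnS ltnW.
pose i := Ordinal rn; have hi : elliptic_pair i = false by apply: negPf; apply: hyp.
pose p : 'cV[F]_(2 * n) * 'cV[F]_(2 * n) :=
  (delta_mx (ord_fst i) 0, delta_mx (ord_snd i) 0).
have hp : p \in hyppairs gram E.
  apply/hyppairsP; rewrite !bform_gram_fst !bform_gram_snd hi !mxE !eqxx.
  rewrite ord_fst_neq_snd eq_sym ord_fst_neq_snd /=; split=> //; apply/fixvP.
    rewrite fE; apply/forallP => j; apply/implyP => jr.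
    rewrite !mxE (inj_eq (@ord_fst_inj n)) (eq_sym (ord_snd _)) ord_fst_neq_snd.
    by rewrite (_ : (j == i) = false) ?eqxx //;
      apply: contraTF jr => /eqP ->; rewrite ltnn.
  rewrite fE; apply/forallP => j; apply/implyP => jr.
  rewrite !mxE (inj_eq (@ord_snd_inj n)) ord_fst_neq_snd.
  by rewrite (_ : (j == i) = false) ?eqxx //;
      apply: contraTF jr => /eqP ->; rewrite ltnn.
have pH := hypproj_orthoproj bform_gramC hp.
have EH := hypproj_sub hp.
have rH := rank_hypproj bform_gramC bform_gram_nondegenerate pE hp.
have rE' : \rank (E - hypproj gram p.1 p.2) = (n - r.+1).*2.
  by apply/eqP; rewrite -2!eqSS -rH rE -doubleS subnSK.
exists (E - hypproj gram p.1 p.2); split=> //.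
- exact: (orthoproj_sub bform_gramC bform_gram_nondegenerate).
- move=> x; rewrite (mem_fixv_hypproj bform_gramC bform_gram_nondegenerate pE hp) fE.
  rewrite ![bform gram (delta_mx _ _) x]bform_gramC bform_gram_fst bform_gram_snd hi.
  apply/andP/forallP => [[/forallP xr /andP[xs xf]] j|xr].
    apply/implyP; rewrite ltnS leq_eqVlt => /orP[/eqP jr|]; last exact/implyP/xr.
    by have -> : j = i by [apply/val_inj]; rewrite xf xs.
  have /implyP/(_ (ltnSn r))/andP[-> ->] := xr i; split=> //.
  by apply/forallP => j; apply/implyP => jr; have /implyP := xr j; apply; apply: ltnW.
(* Substituting this count into the identity for [r] yields the one for [r + 1]; both are stated as
   equalities of sums to avoid truncated subtraction. *)
have := card_singv_hypproj bform_gramC bform_gram_nondegenerate two_neq0 pE hp.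
rewrite rE' => sE; move: cE; rewrite sE -(subnSK rn) doubleS !expnS.
have q0 : (0 < #|F|)%N by apply/card_gt0P; exists 0.
move: (#|F| ^ (n - r.+1).*2)%N (#|F| ^ r)%N (#|F| ^ n.*2)%N #|singv _ _| #|singv _ _|.
rewrite -(prednK q0) /=; move: (#|F|.-1) => q A B C Z1 Z2.
nia.
Qed.

Definition witt_sign (R : pzRingType) : R := if s is Plus then 1 else - 1.

(** Splitting off [r] hyperbolic planes leaves a space in which only [0] is singular: the zero space
    with [r = n] for [Plus], the elliptic plane with [r = n - 1] for [Minus]. Then [Q] times the
    count is [Q^(2n) + Q^(r+1) - Q^(2n-r)]. *)
Lemma card_singv_gram (R : realFieldType) : (0 < n)%N ->
  let Q : R := #|F|%:R in
  Q * #|singv gram 1%:M|%:R = Q ^+ n.*2 + witt_sign R * Q ^+ n * (Q - 1).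
Proof.
move=> n_gt0 Q.
have natR (k l : nat) : k = l -> (k%:R : R) = l%:R by move->.
rewrite /witt_sign; case sE: s.
  have [i _|E [pE rE fE]] := split_hyperbolic_planes (leqnn n).
    by rewrite /elliptic_pair sE.
  have -> : singv gram E = [set 0].
    apply/setP=> x; rewrite in_set1; apply/idP/eqP => [|->]; last exact: singv0.
    rewrite in_set fE => /andP[/forallP x0 _].
    by apply: coord_eq0 => i; have /implyP/(_ (ltn_ord i))/andP[/eqP ? /eqP ?] := x0 i.
  rewrite subnn cards1 => /natR; rewrite !(natrD, natrM, natrX) -/Q => e.
  rewrite (canRL (addrK _) e) exprS; ring.
have n1 : n.-1.+1 = n by rewrite prednK.
have [i|E [pE rE fE]] := split_hyperbolic_planes (leq_pred n).
  by rewrite /elliptic_pair sE => ilt; apply/eqP => e; move: ilt; rewrite -{2}e /= ltnn.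
have -> : singv gram E = [set 0].
  apply/setP=> x; rewrite in_set1; apply/idP/eqP => [|->]; last exact: singv0.
  rewrite in_set fE => /andP[/forallP x0].
  have last_n : (n.-1 < n)%N by rewrite n1.
  pose l := Ordinal last_n.
  have xl i : i != l -> (x (ord_fst i) 0 = 0) /\ (x (ord_snd i) 0 = 0).
    move=> il; have ilt : (i < n.-1)%N.
      by rewrite ltn_neqAle -val_eqE in il *; rewrite il -ltnS n1 /=.
    by have /implyP/(_ ilt)/andP[/eqP ? /eqP ?] := x0 i.
  have ell : elliptic_pair l by rewrite /elliptic_pair sE /= n1.
  rewrite bform_gram (bigD1 l) //= big1 => [|i /xl[-> ->]]; last first.
    by case: ifP => _; ring.
  rewrite ell addr0 mulf_eq0 (negPf two_neq0) /= subr_eq0 -!expr2 => /eqP xx.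
  (* Otherwise [delta] would be the square of the quotient of the two coordinates. *)
  have xs : x (ord_snd l) 0 = 0.
    apply/eqP/negPn/negP => xs; apply: delta_nonsquare.
    exists (x (ord_fst l) 0 / x (ord_snd l) 0).
    by rewrite expr_div_n xx mulfK // expf_neq0.
  have xf : x (ord_fst l) 0 = 0.
    by apply/eqP; move: xx; rewrite xs expr0n mulr0 => /eqP; rewrite expf_eq0.
  by apply: coord_eq0 => i; have [->|/xl[]//] := eqVneq i l.
rewrite n1 -subn1 subKn // cards1 => /natR; rewrite !(natrD, natrM, natrX) -/Q => e.
have Qn : Q ^+ n = Q * Q ^+ (n - 1) by rewrite -exprS -subSn // subn1.
by rewrite (canRL (addrK _) e) Qn exprS expr1; ring.
Qed.

(** Apply [card_subprojs_odd] with [b = m - a]. Dividing by [Q^(n^2)] with [n = m + 1] leaves the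
    exponent [4ab - m^2 = - (m - 2a)^2]; since [4ab <= (a + b)^2], the subtraction of natural
    numbers is exact. *)
Lemma num_sqrt1_improper (R : realFieldType) m : n = m.+1 ->
  let Q : R := #|F|%:R in
  (num_sqrt1 (Ogrp delta s n :\: SOgrp delta s n))%:R / Q ^+ (n ^ 2) =
  (1 - witt_sign R / Q ^+ n) *
  \sum_(a < m.+1) Q^-1 ^+ (m ^ 2 - 4 * (a * (m - a))) *
    (phi Q^-1 m / (phi Q^-1 a * phi Q^-1 (m - a))).
Proof.
move=> nm Q.
rewrite /num_sqrt1 improper_involutions.
rewrite (card_improper_involutions bform_gramC two_neq0).
have dm : (2 * n = m.+1.*2)%N by rewrite mul2n nm.
rewrite (card_odd_orthoprojs gram dm).
rewrite natr_sum mulr_suml mulr_sumr; apply: eq_bigr => a _.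
have am : (a + (m - a) = m)%N by rewrite subnKC // -ltnS.
have := @card_subprojs_odd F _ gram bform_gramC bform_gram_nondegenerate two_neq0 R
  (witt_sign R) a (m - a) 1%:M.
have Qn : Q ^+ m.+1 = Q ^+ n by rewrite nm.
have n2 : m.+1.*2 = n.*2 by rewrite nm.
rewrite am /= Qn n2 => -> //.
- have Q0 : Q != 0.
    by rewrite pnatr_eq0 -lt0n; apply/card_gt0P; exists 0.
  have key : Q ^+ (m.*2.+1 + 4 * (a * (m - a))) / Q ^+ (n ^ 2) =
             Q^-1 ^+ (m ^ 2 - 4 * (a * (m - a))).
    apply: (mulIf (expf_neq0 (n ^ 2) Q0)); rewrite divfK ?expf_neq0 //.
    have -> : (n ^ 2 = (m.*2.+1 + 4 * (a * (m - a))) + (m ^ 2 - 4 * (a * (m - a))))%N.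
      have : (4 * (a * (m - a)) <= m ^ 2)%N.
        by have [] := nat_AGM2 a (m - a); rewrite am.
      rewrite nm -!mulnn; lia.
    rewrite [in RHS](exprD _ (m.*2.+1 + 4 * (a * (m - a)))) mulrCA exprVn.
    by rewrite mulVf ?mulr1 // expf_neq0.
  rewrite -key; ring.
- by rewrite /witt_sign; case: s; rewrite ?sqrrN expr1n.
- exact: orthoproj1.
- by rewrite mxrank1 mul2n.
- by apply: card_singv_gram; rewrite nm.
Qed.

End StandardForm.

(** * The finite triple product *)

(* The Gaussian binomial coefficient with base [x ^+ 2]. *)
Fixpoint qbin (R : fieldType) (x : R) n k : R :=
  match n, k with
  | _, 0 => 1
  | 0, _.+1 => 0
  | n'.+1, k'.+1 => qbin x n' k'.+1 + x ^+ (n' - k').*2 * qbin x n' k'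
  end.

Lemma qbin0 (R : fieldType) (x : R) n : qbin x n 0 = 1.
Proof. by case: n. Qed.

Lemma qbinS (R : fieldType) (x : R) n k :
  qbin x n.+1 k.+1 = qbin x n k.+1 + x ^+ (n - k).*2 * qbin x n k.
Proof. by []. Qed.

Lemma qbin_small (R : fieldType) (x : R) n k : (n < k)%N -> qbin x n k = 0.
Proof.
elim: n k => [|n IHn] [|k] //; rewrite ltnS => nk.
by rewrite qbinS !IHn ?mulr0 ?addr0 // ltnW.
Qed.

(** In the induction, with [ya = x^(2a+2)] and [yb = x^(2b+2)], the two terms of the Pascal
    recursion contribute [1 - yb] and [yb (1 - ya)], whose sum is [1 - ya yb]. *)
Lemma qbin_phi (R : fieldType) (x : R) a b :
  qbin x (a + b) a * (phi x a * phi x b) = phi x (a + b).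
Proof.
have [n] := ubnP (a + b)%N; elim: n a b => // n IHn [|a] [|b] abn.
- by rewrite qbin0 !phi0 !mul1r.
- by rewrite qbin0 phi0 !mul1r.
- have := IHn a 0%N; rewrite addn0 in abn *; rewrite addn0 => /(_ abn) e.
  rewrite qbinS qbin_small // subnn expr0 add0r mul1r phi0 mulr1.
  by rewrite !phiS -[in RHS]e phi0 mulr1 mulrA.
have e1 := IHn a.+1 b; have e2 := IHn a b.+1.
rewrite addnS -!addSnnS in e2 *; rewrite ltnS addnS -addSn in abn.
rewrite qbinS phiS (phiS _ b) (phiS _ (a.+1 + b)).
have -> : (a.+1 + b - a = b.+1)%N by lia.
move: (e1 abn) (e2 abn); rewrite phiS (phiS _ b) => <- e3.
move: e3; rewrite -addnS (addSnnS a b) addnS doubleS => e3.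
have -> : x ^+ (a + b).+2.*2 = x ^+ a.+1.*2 * x ^+ b.*2.+2.
  by rewrite -exprD; congr (_ ^+ _); lia.
move: e3; move: (x ^+ a.+1.*2) (x ^+ b.*2.+2) => ya yb e3.
rewrite mulrDl -[X in _ + X]mulrA [X in _ + _ * X](_ : _ = (1 - ya) *
  (qbin x (a + b).+1 a * (phi x a * (phi x b * (1 - yb))))); last by ring.
by rewrite e3; ring.
Qed.

(** The q-binomial theorem in base [x^2]: multiplying by the last factor reproduces the Pascal
    recursion of [qbin] coefficient by coefficient. *)
Lemma qbinomial (R : fieldType) (x t : R) n :
  \prod_(i < n) (1 + t * x ^+ i.*2) =
  \sum_(k < n.+1) x ^+ (k * k.-1) * qbin x n k * t ^+ k.
Proof.
elim: n => [|n IHn].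
  by rewrite big_ord0 big_ord1 qbin0 !mulr1 expr0.
rewrite big_ord_recr /= IHn mulrDr mulr1 [RHS]big_ord_recl.
rewrite [X in _ = _ + X](eq_bigr (fun k : 'I_n.+1 =>
   x ^+ (k.+1 * k) * qbin x n k.+1 * t ^+ k.+1 +
   (x ^+ (k * k.-1) * qbin x n k * t ^+ k) * (t * x ^+ n.*2))); last first.
  move=> k _; rewrite lift0 exprS.
  have -> : x ^+ n.*2 = x ^+ (n - k).*2 * x ^+ k.*2.
    by rewrite -exprD -doubleD subnK // -ltnS.
  rewrite -[k.+1.-1]/(nat_of_ord k).
  have -> : (k.+1 * k = k.*2 + k * k.-1)%N by case: (nat_of_ord k) => //= j; lia.
  by rewrite exprD; ring.
rewrite big_split /= -mulr_suml addrA; congr (_ + _).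
have -> : \sum_(k < n.+1) x ^+ (k * k.-1) * qbin x n k * t ^+ k =
          \sum_(k < n.+2) x ^+ (k * k.-1) * qbin x n k * t ^+ k.
  by rewrite [RHS]big_ord_recr /= (qbin_small _ (ltnSn n)) mulr0 mul0r addr0.
by rewrite big_ord_recl qbin0; congr (_ + _); apply: eq_bigr => k _; rewrite lift0.
Qed.

Lemma sum_even_odd (V : nmodType) (g : nat -> V) n :
  \sum_(k < n.*2.+1) g k = \sum_(a < n.+1) g a.*2 + \sum_(a < n) g a.*2.+1.
Proof.
elim: n => [|n IHn]; first by rewrite !big_ord1 big_ord0 addr0.
rewrite doubleS 2!big_ord_recr /= IHn [in RHS]big_ord_recr /=.
rewrite [X in _ = _ + X]big_ord_recr /=.
by rewrite -addrA [g _ + g _]addrC addrACA.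
Qed.

Definition theta_prod (R : fieldType) (x z : R) n :=
  \prod_(i < n) (1 + z * x ^+ i.*2.+1) ^+ 2.

(* A finite form of Jacobi's triple product identity. *)
Lemma theta_prod_expand (R : fieldType) (x z : R) n : x != 0 -> z ^+ 2 = 1 ->
  theta_prod x z n = z ^+ n *
  \sum_(k < n.*2.+1) x ^+ (n ^ 2 + k ^ 2) / x ^+ (k * n.*2) * qbin x n.*2 k * z ^+ k.
Proof.
(* With this [t], the factor of index [n + j] is [1 + z x^(2j+1)], and that of index [n - 1 - j] is
   [1 + z / x^(2j+1) = (z / x^(2j+1)) (1 + z x^(2j+1))] because [z^2 = 1]. Both halves thus give the
   same product. *)
move=> x0 z2; pose t := z * x / x ^+ n.*2.
have split_half (f : nat -> R) :
    \prod_(i < n.*2) f i = (\prod_(i < n) f i) * \prod_(i < n) f (n + i)%N.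
  by rewrite -addnn big_split_ord.
have := qbinomial x t n.*2; rewrite (split_half (fun i => 1 + t * x ^+ i.*2)).
have lowE : \prod_(i < n) (1 + t * x ^+ i.*2) =
   z ^+ n / x ^+ (n ^ 2) * \prod_(i < n) (1 + z * x ^+ i.*2.+1).
  rewrite (reindex_inj rev_ord_inj) /=.
  have -> : z ^+ n / x ^+ (n ^ 2) = \prod_(i < n) (z / x ^+ i.*2.+1).
    elim: (n) => [|m IHm]; first by rewrite big_ord0 divr1.
    rewrite big_ord_recr /= -IHm exprSr mulrACA -invfM -exprD.
    by congr (_ * _ / _ ^+ _); lia.
  rewrite -big_split /=; apply: eq_bigr => i _.
  have -> : t = z / (x ^+ i.*2.+1 * x ^+ (n - i.+1).*2).
    rewrite /t -mulrA -exprD; congr (_ * _).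
    have -> : (i.*2.+1 + (n - i.+1).*2 = n.*2.-1)%N by have := ltn_ord i; lia.
    have n0 : (0 < n.*2)%N by have := ltn_ord i; lia.
    by rewrite -{1}(prednK n0) exprS invfM mulVKf.
  by rewrite -{1}z2; field; rewrite !expf_neq0.
have highE : \prod_(i < n) (1 + t * x ^+ (n + i).*2) =
   \prod_(i < n) (1 + z * x ^+ i.*2.+1).
  apply: eq_bigr => i _; rewrite /t doubleD exprD exprS; congr (1 + _).
  by field; rewrite expf_neq0.
rewrite lowE highE => e.
rewrite /theta_prod prodrXl.
have zn : z ^+ n * z ^+ n = 1 by rewrite -expr2 -exprM mulnC exprM z2 expr1n.
have z0 : z != 0 by apply/eqP => z0; have /eqP := z2; rewrite z0 expr0n eq_sym oner_eq0.
have zx0 : z ^+ n / x ^+ (n ^ 2) != 0 by rewrite mulf_neq0 ?invr_eq0 ?expf_neq0.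
apply: (mulfI zx0).
rewrite expr2 mulrA e mulrA mulr_sumr; apply: eq_bigr => k _.
rewrite /t !exprMn exprVn -exprM [z ^+ n / _ * _]mulrAC zn mul1r.
have -> : (k ^ 2 = k * k.-1 + k)%N by case: (nat_of_ord k) => // j; rewrite -mulnn; lia.
rewrite (mulnC n.*2) !exprD; field.
by rewrite !expf_neq0.
Qed.

(** The sign [(-1)^n] cancels the factor [z^n] of the expansion, so averaging over [z = 1] and
    [z = -1] keeps the even [k = 2a], with exponent [n^2 + 4a^2 - 4an]. *)
Lemma theta_prod_even_terms (R : numFieldType) (x : R) n : x != 0 ->
  (theta_prod x 1 n + (-1) ^+ n * theta_prod x (-1) n) / 2%:R =
  \sum_(a < n.+1) x ^+ (n ^ 2 - 4 * (a * (n - a))) *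
    qbin x n.*2 a.*2.
Proof.
move=> x0; pose w k := x ^+ (n ^ 2 + k ^ 2) / x ^+ (k * n.*2) * qbin x n.*2 k.
rewrite !theta_prod_expand ?sqrrN ?expr1n // mul1r mulrA -expr2 -exprM mulnC exprM sqrrN.
rewrite !expr1n mul1r.
rewrite (sum_even_odd (fun k => w k * 1 ^+ k)) (sum_even_odd (fun k => w k * (-1) ^+ k)).
rewrite addrACA -!big_split /= [X in _ + X]big1 => [|a _]; last first.
  by rewrite expr1n exprS -muln2 mulnC exprM sqrrN !expr1n !mulr1 mulrN1 subrr.
rewrite addr0 mulr_suml; apply: eq_bigr => a _.
have -> : (-1) ^+ a.*2 = 1 :> R by rewrite -muln2 mulnC exprM sqrrN !expr1n.
rewrite expr1n mulr1 -mulr2n -[w _ *+ 2]mulr_natr mulfK ?pnatr_eq0 //.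
rewrite /w; congr (_ * _); apply: (canLR (mulfK _)); first by rewrite expf_neq0.
rewrite -exprD; congr (_ ^+ _); have an : (a <= n)%N by rewrite -ltnS.
have := nat_AGM2 a (n - a); rewrite subnKC // => -[le_4ab _].
move: le_4ab; rewrite mulnBr -!mulnn; nia.
Qed.

(** * Estimates for a base [x] of at most [1/3] *)

Section SmallBase.
Variables (R : realFieldType) (x : R).
Hypothesis x_bounds : 0 < x <= 3%:R^-1.

Let x_gt0 : 0 < x. Proof. by case/andP: x_bounds. Qed.
Let x_ge0 : 0 <= x. Proof. exact: ltW. Qed.
Let x_le1 : x <= 1. Proof. by case/andP: x_bounds => _; lra. Qed.
Let x3_le1 : 3%:R * x <= 1.
Proof. by case/andP: x_bounds => _; lra. Qed.
Let xn_gt0 n : 0 < x ^+ n. Proof. exact: exprn_gt0. Qed.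
Let xn_le1 n : x ^+ n <= 1. Proof. exact: exprn_ile1. Qed.
Let x2_le k : 3%:R * x ^+ (k.+1).*2 <= x ^+ k.*2.
Proof.
rewrite doubleS !exprS mulrA -[leRHS]mul1r mulrA ler_pM2r // -mulrA.
by apply: le_trans x3_le1; rewrite ler_pM2l // ler_piMl.
Qed.

Lemma phi_gt0 n : 0 < phi x n.
Proof.
apply: prodr_gt0 => i _; rewrite subr_gt0 exprn_ilt1 //.
by have := x3_le1; lra.
Qed.

Lemma phi_add_le k j : phi x (k + j) <= phi x k.
Proof.
elim: j => [|j]; first by rewrite addn0.
apply: le_trans; rewrite addnS phiS ler_piMr ?(ltW (phi_gt0 _)) //.
by rewrite gerBl ltW.
Qed.

Lemma phi_add_ge k j : phi x k * (1 - x ^+ k.*2 / 2%:R) <= phi x (k + j).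
Proof.
(* The induction on [j] needs the sharper bound with the factor [1 - x^(2j)]; its step rests on
   [3 x^(2j+2) <= x^(2j)]. *)
apply: (@le_trans _ _ (phi x k * (1 - x ^+ k.*2 / 2%:R * (1 - x ^+ j.*2)))).
  rewrite ler_pM2l ?phi_gt0 // lerB // ler_piMr ?gerBl ?ltW //.
  by rewrite divr_gt0.
elim: j => [|j IHj]; first by rewrite expr0 subrr mulr0 subr0 mulr1 addn0.
rewrite addnS phiS; apply: (@le_trans _ _ (phi x k *
  (1 - x ^+ k.*2 / 2%:R * (1 - x ^+ j.*2)) * (1 - x ^+ (k + j).+1.*2))); last first.
  by rewrite ler_wpM2r // subr_ge0.
rewrite -[leRHS]mulrA ler_pM2l ?phi_gt0 //.
have := xn_gt0 k.*2; have := xn_le1 k.*2; have := xn_gt0 j.*2; have := xn_le1 j.*2.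
have -> : x ^+ (k + j).+1.*2 = x ^+ k.*2 * x ^+ (j.+1).*2.
  by rewrite -exprD; congr (_ ^+ _); lia.
have := x2_le j; have := xn_gt0 j.+1.*2.
move: (x ^+ k.*2) (x ^+ j.*2) (x ^+ j.+1.*2) => u v w w0 wv v1 v0 u1 u0.
have : 0 <= u * (v - 3%:R * w) by rewrite mulr_ge0 ?subr_ge0 // ltW.
have : 0 <= u * (1 - v) * (u * w) by rewrite !mulr_ge0 ?subr_ge0 // ltW.
by nra.
Qed.

Lemma phi_ge_half n : 2%:R^-1 <= phi x n.
Proof. by have := phi_add_ge 0 n; rewrite phi0 add0n expr0; lra. Qed.

Lemma phi_le1 n : phi x n <= 1.
Proof. by have := phi_add_le 0 n; rewrite phi0. Qed.

(** Doubling the index [k] multiplies [phi] by a factor between [1 - x^(2k) / 2] and [1]. For the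
    denominators [A >= B] and [K = x^(2a) + x^(2b)], the cross difference of the fractions is at
    most [K A / 2]; as [phi >= 1/2] gives [B >= 1/4], dividing by [A B] leaves at most [2 K]. *)
Lemma phi_binomial_double a b :
  `|phi x (a + b) / (phi x a * phi x b) -
    phi x (a + b).*2 / (phi x a.*2 * phi x b.*2)| <=
  2%:R * (x ^+ a.*2 + x ^+ b.*2).
Proof.
have le_phi n : phi x n.*2 <= phi x n by rewrite -addnn phi_add_le.
have ge_phi n : phi x n * (1 - x ^+ n.*2 / 2%:R) <= phi x n.*2.
  by rewrite -[in leRHS]addnn phi_add_ge.
have gle : x ^+ (a + b).*2 <= x ^+ a.*2.
  by rewrite doubleD exprD ler_piMr // ltW.
move: (le_phi a) (le_phi b) (le_phi (a + b)%N) (ge_phi a) (ge_phi b) (ge_phi (a + b)%N).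
move: (phi_ge_half a.*2) (phi_ge_half b.*2) (phi_le1 (a + b)).
move: (phi_ge_half a) (phi_ge_half b) (phi_ge_half (a + b)).
move: (xn_gt0 a.*2) (xn_gt0 b.*2) (xn_gt0 (a + b).*2) (xn_le1 a.*2) (xn_le1 b.*2) gle.
move: (x ^+ a.*2) (x ^+ b.*2) (x ^+ (a + b).*2) => al be ga.
move: (phi x a) (phi x b) (phi x (a + b)) (phi x a.*2) (phi x b.*2) (phi x (a + b).*2).
move=> ua ub u va vb v al0 be0 ga0 al1 be1 gaal ua2 ub2 u2 va2 vb2 u1 vua vub vu lva lvb lv.
have ua0 : 0 < ua by lra.
have ub0 : 0 < ub by lra.
have va0 : 0 < va by lra.
have vb0 : 0 < vb by lra.
have u0 : 0 < u by lra.
have uab : 0 < ua * ub by apply: mulr_gt0.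
have vab : 4%:R^-1 <= va * vb.
  have : 0 <= (va - 2%:R^-1) * (vb - 2%:R^-1) by rewrite mulr_ge0 ?subr_ge0.
  by nra.
have vab_le : va * vb <= ua * ub by apply: ler_pM => //; exact: ltW.
have vab_ge : ua * ub * (1 - (al + be) / 2%:R) <= va * vb.
  apply: (@le_trans _ _ ((ua * (1 - al / 2%:R)) * (ub * (1 - be / 2%:R)))).
    rewrite mulrACA ler_pM2l //.
    have : 0 <= al * be by rewrite mulr_ge0 ?ltW.
    by lra.
  by apply: ler_pM => //; rewrite mulr_ge0 ?ltW //; lra.
move: uab vab vab_le vab_ge; move: (ua * ub) (va * vb) => A B A0 B4 BA AB.
have B0 : 0 < B by lra.
have -> : u / A - v / B = (u * B - v * A) / (A * B) by field; rewrite !gt_eqF.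
rewrite normrM normfV ler_pdivrMr ?normr_gt0 ?mulf_neq0 ?gt_eqF //.
rewrite (gtr0_norm (mulr_gt0 A0 B0)) ler_norml.
have AB4 : A <= 4%:R * (A * B).
  by rewrite mulrCA -[leLHS]mulr1 ler_pM2l //; lra.
set K := al + be.
have K0 : 0 <= K by rewrite /K; lra.
have KA : K * A <= K * (4%:R * (A * B)) by rewrite ler_wpM2l.
have uKA : u * (K * A) <= K * A.
  by rewrite ler_piMl // mulr_ge0 // ltW.
apply/andP; split.
  have : v * A <= u * A by rewrite ler_pM2r.
  have : u * (A * (1 - K / 2%:R)) <= u * B by rewrite ler_pM2l.
  by nra.
have : u * B <= u * A by rewrite ler_pM2l.
have : u * (1 - ga / 2%:R) * A <= v * A by rewrite ler_pM2r.
have : u * A * ga <= u * A * K.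
  by rewrite ler_pM2l ?mulr_gt0 // /K; lra.
by nra.
Qed.

(** With [e = n - 2a], the exponents obtained are [e^2 + 2a = n + e^2 - e] and
    [e^2 + 2 (n - a) = n + e^2 + e]. Both are at least [n] since [e] is an integer, so each of the
    [n + 1] terms is at most [4 x^n]. *)
Lemma sum_phi_binomial_double n :
  `|\sum_(a < n.+1) x ^+ (n ^ 2 - 4 * (a * (n - a))) *
       (phi x n / (phi x a * phi x (n - a))) -
    \sum_(a < n.+1) x ^+ (n ^ 2 - 4 * (a * (n - a))) * qbin x n.*2 a.*2| <=
  4%:R * (n.+1%:R * x ^+ n).
Proof.
rewrite -sumrB (le_trans (ler_norm_sum _ _ _)) //.
have -> : 4%:R * (n.+1%:R * x ^+ n) = \sum_(a < n.+1) 4%:R * x ^+ n.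
  by rewrite sumr_const card_ord -mulr_natr; ring.
apply: ler_sum => a _; have an : (a <= n)%N by rewrite -ltnS.
have := phi_binomial_double a (n - a); rewrite subnKC // => le_phi.
have -> : qbin x n.*2 a.*2 = phi x n.*2 / (phi x a.*2 * phi x (n - a).*2).
  have := qbin_phi x a.*2 (n - a).*2; rewrite -doubleD subnKC // => <-.
  by rewrite mulfK // mulf_neq0 // gt_eqF // phi_gt0.
rewrite -mulrBr normrM (gtr0_norm (xn_gt0 _)).
apply: (le_trans (ler_wpM2l (ltW (xn_gt0 _)) le_phi)).
rewrite mulrCA mulrDr -!exprD -[4%:R]/((2 * 2)%:R) natrM -mulrA ler_pM2l //.
rewrite mulr_natl mulr2n.
have := nat_AGM2 a (n - a); rewrite subnKC // => -[le_4ab _].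
by rewrite lerD // ler_wiXn2l //; move: le_4ab; rewrite mulnBr -!mulnn; nia.
Qed.

(** The subtracted [x^(2n)] lets the induction close; what is used later is the uniform bound
    [2]. *)
Lemma prod_odd_expr_le n : \prod_(i < n) (1 + x ^+ i.*2.+1) <= 2%:R - x ^+ n.*2.
Proof.
elim: n => [|n IHn]; first by rewrite big_ord0 expr0; lra.
rewrite big_ord_recr /=.
apply: (@le_trans _ _ ((2%:R - x ^+ n.*2) * (1 + x ^+ n.*2.+1))).
  by rewrite ler_wpM2r // addr_ge0 // ltW.
rewrite doubleS !exprS; have := xn_gt0 n.*2; move: (x ^+ n.*2) => u u0.
have := x3_le1.
have : 0 <= u * (1 - 3%:R * x) by rewrite mulr_ge0 ?subr_ge0 // ltW.
have : 0 <= u * x * (1 - x) by rewrite !mulr_ge0 ?subr_ge0 // ltW.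
have : 0 <= u * u * x by rewrite !mulr_ge0 // ltW.
by nra.
Qed.

End SmallBase.

(* Only now: classical sets shadow the finite-set lemmas used above. *)
From mathcomp Require Import all_classical all_reals all_analysis.
Import numFieldNormedType.Exports.

Local Open Scope classical_set_scope.
Local Open Scope ring_scope.

Lemma theta_prod_infprod1 (R : realType) (c : R) (q : nat) :
  infprod1 (fun i => (1 + c * (1 / q%:R ^+ (2 * i - 1))) ^+ 2) =
  limn (theta_prod (q%:R^-1) c).
Proof.
rewrite /infprod1; congr (limn _); apply/funext => n.
rewrite /theta_prod big_add1 /= big_mkord; apply: eq_bigr => i _.
rewrite exprVn mul1r; congr ((1 + c * (_ ^+ _)^-1) ^+ 2); lia.
Qed.

(** * Convergence of the products and of the normalised count *)

Section Limits.
Variables (R : realType) (x : R).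
Hypothesis x_bounds : 0 < x <= 3%:R^-1.

Let x_gt0 : 0 < x. Proof. by case/andP: x_bounds. Qed.
Let x_lt1 : x < 1. Proof. by case/andP: x_bounds => _; lra. Qed.

(** Increasing, and bounded by the square of the bound [2] on the unsquared products. *)
Lemma cvgn_theta_prod1 : cvgn (theta_prod x 1).
Proof.
apply: nondecreasing_is_cvgn.
  apply/nondecreasing_seqP => n; rewrite /theta_prod big_ord_recr /=.
  apply: ler_peMr; first by apply: prodr_ge0 => i _; rewrite sqr_ge0.
  by rewrite mul1r exprn_ege1 // lerDl exprn_ge0 // ltW.
exists 4%:R => _ [n _ <-]; rewrite /theta_prod prodrXl.
have : \prod_(i < n) (1 + 1 * x ^+ i.*2.+1) <= 2%:R.
  under eq_bigr => i _ do rewrite mul1r.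
  by apply: (le_trans (prod_odd_expr_le x_bounds n)); rewrite gerBl exprn_ge0 // ltW.
have : 0 <= \prod_(i < n) (1 + 1 * x ^+ i.*2.+1).
  by apply: prodr_ge0 => i _; rewrite mul1r addr_ge0 ?exprn_ge0 // ltW.
by nra.
Qed.

Lemma cvgn_theta_prodN1 : cvgn (theta_prod x (-1)).
Proof.
apply: nonincreasing_is_cvgn.
  apply/nonincreasing_seqP => n; rewrite /theta_prod big_ord_recr /=.
  apply: ler_piMr; first by apply: prodr_ge0 => i _; rewrite sqr_ge0.
  have : 0 <= x ^+ n.*2.+1 by rewrite exprn_ge0 // ltW.
  have : x ^+ n.*2.+1 <= 1 by rewrite exprn_ile1 // ltW.
  by rewrite mulN1r expr2; nra.
by exists 0 => _ [n _ <-]; apply: prodr_ge0 => i _; rewrite sqr_ge0.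
Qed.

(** Squeezed by [(2x)^n], as [n + 1 <= 2^n] and [2x < 1]. *)
Lemma cvgn_succ_mul_expr : (fun n => n.+1%:R * x ^+ n) @ \oo --> (0 : R).
Proof.
have x2_lt1 : `|2%:R * x| < 1.
  by rewrite gtr0_norm ?mulr_gt0 //; case/andP: x_bounds => _; lra.
apply: (@squeeze_cvgr _ _ _ _ (fun=> 0) (fun n => (2%:R * x) ^+ n)).
- apply: nearW => n; rewrite mulr_ge0 ?exprn_ge0 ?(ltW x_gt0) //=.
  by rewrite exprMn ler_wpM2r ?exprn_ge0 ?(ltW x_gt0) // -natrX ler_nat ltn_expl.
- exact: cvg_cst.
- exact: cvg_expr.
Qed.

(** The sum [T_N] of the opening comment, at [N = n]. *)
Definition phi_sum n := \sum_(a < n.+1) x ^+ (n ^ 2 - 4 * (a * (n - a))) *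
  (phi x n / (phi x a * phi x (n - a))).

Lemma cvg_phi_sum_theta (u : nat -> nat) : u @ \oo --> \oo ->
  (fun m => phi_sum (u m) -
     (theta_prod x 1 (u m) + (-1) ^+ u m * theta_prod x (-1) (u m)) / 2%:R) @ \oo
  --> (0 : R).
Proof.
move=> u_oo.
suff : (fun n => phi_sum n -
     (theta_prod x 1 n + (-1) ^+ n * theta_prod x (-1) n) / 2%:R) @ \oo --> (0 : R).
  by move=> h; apply: (cvg_comp _ _ u_oo h).
apply/norm_cvg0P.
have h : (fun n => 4%:R * (n.+1%:R * x ^+ n)) @ \oo --> (0 : R).
  rewrite -[X in _ --> X](mulr0 (4%:R : R)).
  by apply: cvgM; [apply: cvg_cst | apply: cvgn_succ_mul_expr].
apply: (squeeze_cvgr _ (@cvg_cst _ _ _ _ _) h); apply: nearW => n /=.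
rewrite normr_ge0 theta_prod_even_terms ?gt_eqF //.
exact: sum_phi_binomial_double.
Qed.

(** Along indices [u m] of one parity the sign [(-1)^N] is a constant [sg], so the combination of
    the two products converges; the factor carrying the type [w] tends to [1]. *)
Lemma cvg_weighted_phi_sum (u : nat -> nat) (w sg : R) : u @ \oo --> \oo ->
  (forall m, (-1) ^+ u m = sg) ->
  (fun m => (1 - w * x ^+ (u m).+1) * phi_sum (u m)) @ \oo -->
  1 / 2%:R * (limn (theta_prod x 1) + sg * limn (theta_prod x (-1))).
Proof.
move=> u_oo usg.
have c1 : theta_prod x 1 (u m) @[m --> \oo] --> limn (theta_prod x 1).
  exact: (cvg_comp _ _ u_oo cvgn_theta_prod1).
have c2 : theta_prod x (-1) (u m) @[m --> \oo] --> limn (theta_prod x (-1)).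
  exact: (cvg_comp _ _ u_oo cvgn_theta_prodN1).
have cx : x ^+ (u m).+1 @[m --> \oo] --> (0 : R).
  have cx0 : x ^+ n.+1 @[n --> \oo] --> (0 : R).
    have := @cvg_expr R x; rewrite ger0_norm ?ltW // => /(_ x_lt1) cx0.
    by rewrite (cvg_shiftS (fun n => x ^+ n)).
  exact: (cvg_comp _ _ u_oo cx0).
rewrite -[X in _ --> X]mul1r; apply: cvgM.
  rewrite -[X in _ --> X]subr0 -[X in _ - X](mulr0 w).
  by apply: cvgB; [apply: cvg_cst | apply: cvgM => //; apply: cvg_cst].
have := cvg_phi_sum_theta u_oo; set e := (fun m => _ - _) => ce.
have -> : (fun m => phi_sum (u m)) =
    (fun m => e m + 1 / 2%:R * (theta_prod x 1 (u m) + sg * theta_prod x (-1) (u m))).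
  by apply/funext => m; rewrite /e usg mul1r [_^-1 * _]mulrC subrK.
rewrite -[X in _ --> X]add0r; apply: cvgD => //.
apply: cvgM; first exact: cvg_cst.
by apply: cvgD => //; apply: cvgM => //; apply: cvg_cst.
Qed.

End Limits.

Theorem theorem7p3 (R : realType) (F : finFieldType) (q : nat)
    (card_F : #|F| = q) (q_odd : odd q)
    (delta : F) (delta_nonsquare : ~ (exists x : F, x ^+ 2 = delta))
    (s : sign) :
  let Pplus : R :=
    infprod1 (fun i => (1 + 1 / q%:R ^+ (2 * i - 1)) ^+ 2) in
  let Pminus : R :=
    infprod1 (fun i => (1 - 1 / q%:R ^+ (2 * i - 1)) ^+ 2) in
  ((fun m : nat =>
      (num_sqrt1 (Ogrp delta s (2 * m) :\: SOgrp delta s (2 * m)))%:R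
        / q%:R ^+ ((2 * m) ^ 2)) @ \oo --> 1 / 2 * (Pplus - Pminus)) /\
  ((fun m : nat =>
      (num_sqrt1 (Ogrp delta s (2 * m + 1) :\: SOgrp delta s (2 * m + 1)))%:R
        / q%:R ^+ ((2 * m + 1) ^ 2)) @ \oo --> 1 / 2 * (Pplus + Pminus)).
Proof.
move=> Pplus Pminus; pose x : R := q%:R^-1.
have two_neq0 : (2%:R : F) != 0 by apply: odd_card_two_neq0; rewrite card_F.
(* This gives [x <= 1/3], the standing hypothesis of the estimates. *)
have q_ge3 : (3 <= q)%N.
  have := card_finNzRing_gt1 F; rewrite card_F.
  by case: (q) q_odd => [|[|[|]]].
have x_bounds : 0 < x <= 3%:R^-1.
  by rewrite invr_gt0 ltr0n lef_pV2 ?posrE ?ltr0n ?ler_nat //; lia.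
have PplusE : Pplus = limn (theta_prod x 1).
  rewrite -theta_prod_infprod1; congr infprod1.
  by apply/funext => i; rewrite [in RHS]mul1r.
have PminusE : Pminus = limn (theta_prod x (-1)).
  rewrite -theta_prod_infprod1; congr infprod1.
  by apply/funext => i; rewrite mulN1r.
have countE m : (num_sqrt1 (Ogrp delta s m.+1 :\: SOgrp delta s m.+1))%:R
      / q%:R ^+ (m.+1 ^ 2) =
    (1 - witt_sign s R * x ^+ m.+1) * phi_sum x m.
  have := num_sqrt1_improper s delta_nonsquare two_neq0 R (erefl m.+1).
  by rewrite card_F /= => ->; rewrite exprVn.
split.
  (* The closed formula needs a positive half dimension, so the term [m = 0] is shifted away. Then
     [N = 2 (m + 1) - 1] is odd, whence the minus sign. *)
  rewrite -cvg_shiftS /=.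
  have -> : (fun m =>
      (num_sqrt1 (Ogrp delta s (2 * m.+1) :\: SOgrp delta s (2 * m.+1)))%:R
        / q%:R ^+ ((2 * m.+1) ^ 2)) =
     (fun m => (1 - witt_sign s R * x ^+ (2 * m).+2) * phi_sum x (2 * m).+1).
    by apply/funext => m; rewrite -countE mulnS.
  rewrite PplusE PminusE -[- limn _]mulN1r.
  apply: (cvg_weighted_phi_sum x_bounds (u := fun m => (2 * m).+1)).
    apply/cvgnyPge => A; near=> m; rewrite (@leq_trans m) ?leq_pmull //.
      by near: m; exact: nbhs_infty_ge.
    by rewrite leqW // leq_pmull.
  by move=> m; rewrite exprS exprM sqrrN !expr1n mulr1.
(* Here [N = 2m] is even, whence the plus sign. *)
have -> : (fun m =>
    (num_sqrt1 (Ogrp delta s (2 * m + 1) :\: SOgrp delta s (2 * m + 1)))%:R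
        / q%:R ^+ ((2 * m + 1) ^ 2)) =
     (fun m => (1 - witt_sign s R * x ^+ (2 * m).+1) * phi_sum x (2 * m)).
  by apply/funext => m; rewrite -countE addn1.
rewrite PplusE PminusE -[X in _ + X]mul1r.
apply: (cvg_weighted_phi_sum x_bounds (u := fun m => (2 * m)%N)).
  exact: (@cvg_mulnl 2).
by move=> m; rewrite exprM sqrrN !expr1n.
Unshelve. all: by end_near.
Qed.
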